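(* Let $-1 \leq \alpha < \infty$. Suppose that $p$ is a uniformly radially log-Hölder continuous exponent on $\overline{\mathbb{D}}$, and let $\widehat{p}(re^{i\theta}) = p(e^{i\theta})$ for $0\le r\le 1$. Then $A_\alpha^{p(\cdot)} = A_\alpha^{\widehat{p}(\cdot)}$ (as sets of analytic functions).
   Context: $\mathbb{D}$ is the open unit disc. For a measurable function $p$, $p_-=\operatorname{ess\,inf} p$ and $p_+=\operatorname{ess\,sup} p$; $p$ is a variable exponent if $0<p_-\le p_+<\infty$. An exponent $p$ on $\overline{\mathbb{D}}$ with $0<p_-\le p_+<\infty$ is uniformly radially log-Hölder continuous if for some fixed $0\le R<1$ there is an absolute constant $C$ such that for each $\theta$, $|p(re^{i\theta})-p(e^{i\theta})|\le \dfrac{C}{-\log(1-r)}$ for $R\le r<1$. Let $dA$ be normalized Lebesgue area measure on $\mathbb{D}$. For $-1<\alpha<\infty$ let $dA_\alpha(z)=(\alpha+1)(1-|z|^2)^\alpha dA(z)$, and let $A^{p(\cdot)}_\alpha$ be the space of analytic functions $f$ on $\mathbb{D}$ with $\int_{\mathbb{D}}|f(z)|^{p(z)}\,dA_\alpha(z)<\infty$. For $\alpha=-1$, $A^{p(\cdot)}_{-1}=H^{p(\cdot)}$ is the space of analytic functions $f$ on $\mathbb{D}$ with $\sup_{0\le r<1}M_{p(\cdot)}(r,f)<\infty$, where $M_{p(\cdot)}(r,f)=\inf\{\lambda>0: \frac1{2\pi}\int_0^{2\pi}|f(re^{i\theta})/\lambda|^{p(re^{i\theta})}\,d\theta<1\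}$.
   Formalization: The exponent p is taken Borel measurable and strictly positive at every point of the closed disc, not only essentially bounded below; otherwise the case α = -1 fails (p = 1 except p = -1 on |z| = 1/2, f = z - 1/2). *)

(* Defs.v *)
From HB Require Import structures.
From mathcomp Require Import all_boot all_order all_algebra.
From mathcomp Require Import complex.
From mathcomp Require Import all_classical all_reals all_analysis.
From mathcomp Require Import measurable_realfun ess_sup_inf.

Set Implicit Arguments.
Unset Strict Implicit.
Unset Printing Implicit Defensive.

Import Order.TTheory GRing.Theory Num.Theory.
Import numFieldNormedType.Exports.

Local Open Scope classical_set_scope.
Local Open Scope complex_scope.
Local Open Scope ring_scope.

(* The modulus as an element of [R]; the norm [`|z|] is an element of [R[i]]. *)
Notation modulus := ComplexField.Normc.normc.

Section variable_exponent_spaces.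
Variable R : realType.

Definition polar (r t : R) : R[i] := r%:C * (cos t +i* sin t).

Definition disc : set R[i] := [set z | modulus z < 1].
Definition closed_disc : set R[i] := [set z | modulus z <= 1].

Local Notation plane := (measurableTypeR R * measurableTypeR R)%type.

(* Measure theory takes place on [R * R], which has the product (Borel)
   sigma-algebra; functions live on [R[i]]. *)
Definition cplx (x : plane) : R[i] := x.1 +i* x.2.

Lemma pi_inv_ge0 : 0 <= pi^-1 :> R. Proof. by rewrite invr_ge0 pi_ge0. Qed.

(* Area measure on the whole plane, normalized so that the disc has measure 1. *)
Definition area : {measure set plane -> \bar R} :=
  mscale (NngNum pi_inv_ge0) (lebesgue_measure \x lebesgue_measure)%E.

Lemma measurable_closed_disc :
  measurable (cplx @^-1` closed_disc : set plane).
Proof.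
have -> : cplx @^-1` closed_disc =
    (fun x : plane => x.1 ^+ 2 + x.2 ^+ 2) @^-1` `]-oo, 1].
  apply/funext => x; rewrite /closed_disc /= in_itv /=.
  by rewrite -[X in Num.sqrt _ <= X]sqrtr1 ler_psqrt ?nnegrE ?addr_ge0 ?sqr_ge0.
rewrite -[X in measurable X]setTI.
have mf : measurable_fun setT (fun x : plane => x.1 ^+ 2 + x.2 ^+ 2).
  by apply: measurable_funD; apply: measurable_funX;
    [exact: measurable_fst|exact: measurable_snd].
by apply: mf => //; exact: measurable_itv.
Qed.

(* The values of functions outside the (closed) disc are irrelevant
   throughout. *)
Definition analytic_on_disc (f : R[i] -> R[i]) : Prop :=
  forall a, disc a -> exists (c : nat -> R[i]) (e : R), 0 < e /\
    forall z, modulus (z - a) < e ->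
      (series (fun n => c n * (z - a) ^+ n) : nat -> R[i]^o) @ \oo -->
      (f z : R[i]^o).

Section exponent.
Variable p : R[i] -> R.

Definition exponent_sup : \bar R :=
  ess_sup (mrestr area measurable_closed_disc) (fun x => (p (cplx x))%:E).
Definition exponent_inf : \bar R :=
  ess_inf (mrestr area measurable_closed_disc) (fun x => (p (cplx x))%:E).

(* The essential bounds do not see any given circle, whereas the means
   defining the Hardy spaces do, which is why values in (0, +oo) are required
   at every point. *)
Definition variable_exponent : Prop :=
  [/\ measurable_fun (cplx @^-1` closed_disc) (p \o cplx),
      forall z, closed_disc z -> 0 < p z &
      [/\ (0 < exponent_inf)%E, (exponent_inf <= exponent_sup)%E &
          (exponent_sup < +oo)%E]].

(* [0 < r] is only there because division by [- ln (1 - 0) = 0] is [0] here: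
   at [r = 0] the bound is to be read as [+oo]. *)
Definition radially_log_holder : Prop :=
  exists r0 : R, 0 <= r0 < 1 /\ exists C : R,
    forall t r, r0 <= r < 1 -> 0 < r ->
      `|p (polar r t) - p (polar 1 t)| <= C / - ln (1 - r).

Definition bergman_space (alpha : R) : set (R[i] -> R[i]) :=
  [set f | analytic_on_disc f /\
    (\int[area]_(x in cplx @^-1` disc)
       ((modulus (f (cplx x)) `^ p (cplx x)) *
        ((alpha + 1) * (1 - modulus (cplx x) ^+ 2) `^ alpha))%R%:E < +oo)%E].

Definition hardy_mean (r : R) (f : R[i] -> R[i]) : \bar R :=
  ereal_inf [set l%:E | l in [set l : R | (0 < l)%R /\
    (((2 * pi)^-1)%R%:E *
     \int[lebesgue_measure]_(t in `[0%R, (2 * pi)%R])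
       (modulus (f (polar r t) / l%:C) `^ p (polar r t))%R%:E < 1)%E]].

Definition hardy_space : set (R[i] -> R[i]) :=
  [set f | analytic_on_disc f /\
    (ereal_sup [set hardy_mean r f | r in [set r : R | (0 <= r < 1)%R]] < +oo)%E].

(* Meant for [-1 <= alpha]. *)
Definition weighted_space (alpha : R) : set (R[i] -> R[i]) :=
  if alpha == -1 then hardy_space else bergman_space alpha.

(* p^(r e^(it)) = p(e^(it)) for 0 < r <= 1. This leaves the value at the origin
   open; here it is [p 0], since [0 / 0 = 0]. *)
Definition radial_exponent (z : R[i]) : R := p (z / `|z|).

End exponent.

End variable_exponent_spaces.

(* Main.v *)
Require Import Defs.
From HB Require Import structures.
From mathcomp Require Import all_boot all_order all_algebra.
From mathcomp Require Import complex.
From mathcomp Require Import all_classical all_reals all_analysis.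
From mathcomp Require Import measurable_realfun ess_sup_inf.
From mathcomp Require Import ring lra.

Import Order.TTheory GRing.Theory Num.Theory.
Import numFieldNormedType.Exports.

Local Open Scope classical_set_scope.
Local Open Scope complex_scope.
Local Open Scope ring_scope.

Set Implicit Arguments.
Unset Strict Implicit.

(** Where [|f| > 1], replacing the exponent [p] by [p^] changes [|f|^p] by the
    factor [|f|^(p^ - p)], and [|p^ - p| <= C / - ln (1 - |z|)]. This factor is
    bounded as soon as [f] has polynomial growth,
    [|f z| <= A (1 - |z|)^(- N)], because then
    [ln |f z| = O(- ln (1 - |z|))]. Small values are harmless: if [q] is a
    lower bound of the exponents and [|f z| <= (1 - |z|)^(1/q)], then
    [|f z|^(p^ z) <= 1 - |z|], which is integrable against
    [(1 - |z|^2)^alpha] because [alpha > -1]. This is [change_exponent]; as the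
    roles of [p] and [p^] are symmetric, one inclusion between the spaces,
    proved for two abstract exponents that are close to each other
    ([bergman_subset], [hardy_subset]), is enough.

    Polynomial growth ([growth_estimate]) follows from the finiteness of
    [I = int |f|^q (1 - |z|^2)^beta], where [q] is at most one and at most the
    essential lower bound of the exponent. The sub-mean value property of [|f|]
    itself suffices for small [q] as well: the factor [|f|^(1 - q)] is absorbed
    into the weighted supremum of [|f|] that is to be bounded.

    The sub-mean value property ([submean_value]) rests on a discrete form of
    Cauchy's theorem. Let [omega] be a root of unity of order [n] close to [1],
    and let [F w] be the sum of [f (z + w omega^k)] over [k < n]. Near any point,
    [f (a + h) - f a + i (f (a + i h) - f a) = O(|h|^2)], since the linear terms
    cancel; with [h = w omega^k (tau - 1)] and
    [tau = 1 - i (omega - 1)], so that [i h = w omega^k (omega - 1)], this says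
    that [F (w tau) - F w] equals [- i (F (w omega) - F w)], which is [0], up to
    [O(n |w|^2 |omega - 1|^2)]. Along the
    spiral [w, w / tau, w / tau^2, ..., 0] these errors add up to
    [O(n |omega - 1|)], hence [F w] is close to [F 0 = n f z]. Integrating over
    [|w| <= delta] uses only that rotations preserve area.

    The definition of an exponent bounds [p] almost everywhere in the disc,
    while [p^] and the Hardy spaces involve its values on circles. The two are
    related by [polar_integral]: averaging over all rotations replaces a
    function on the plane by its circular means. With the continuity of [p]
    along radii it shows that the bounds hold in almost every direction on the
    unit circle ([tame_exponents]), and it turns a bound on circular means into
    a bound on an area integral ([hardy_growth]). *)

(** * The modulus of complex numbers *)

Section modulus_theory.
Variable R : realType.
Implicit Types z w : R[i].

Lemma modulus_ge0 z : 0 <= modulus z.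
Proof. by case: z => a b; rewrite sqrtr_ge0. Qed.

Lemma normr_modulus z : `|z| = (modulus z)%:C.
Proof. by case: z => a b; rewrite normc_def. Qed.

Lemma modulusR (r : R) : modulus r%:C = `|r|.
Proof. by rewrite /= expr0n /= addr0 sqrtr_sqr. Qed.

Lemma modulusM z w : modulus (z * w) = modulus z * modulus w.
Proof. exact: ComplexField.Normc.normcM. Qed.

Lemma modulusV z : modulus z^-1 = (modulus z)^-1.
Proof. exact: ComplexField.Normc.normcV. Qed.

Lemma modulusN z : modulus (- z) = modulus z.
Proof. by case: z => a b /=; rewrite !sqrrN. Qed.

Lemma modulusD z w : modulus (z + w) <= modulus z + modulus w.
Proof. exact: le_normcD. Qed.

Lemma modulusB z w : modulus (z - w) <= modulus z + modulus w.
Proof. by rewrite -[modulus w]modulusN modulusD. Qed.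

Lemma modulusBC z w : modulus (z - w) = modulus (w - z).
Proof. by rewrite -opprB modulusN. Qed.

Lemma modulusX z n : modulus (z ^+ n) = modulus z ^+ n.
Proof.
elim: n => [|n IH]; first by rewrite !expr0 (modulusR 1) normr1.
by rewrite !exprS modulusM IH.
Qed.

Lemma modulus_i : modulus 'i%C = 1 :> R.
Proof. by rewrite /= expr0n /= add0r expr1n sqrtr1. Qed.

Lemma modulus0 : modulus 0 = 0 :> R.
Proof. by rewrite (modulusR 0) normr0. Qed.

Lemma modulus_nat n : modulus n%:R = n%:R :> R.
Proof. by rewrite -[n%:R in LHS](rmorph_nat (real_complex R)) modulusR ger0_norm. Qed.

Lemma modulus_sum n (F : nat -> R[i]) :
  modulus (\sum_(0 <= k < n) F k) <= \sum_(0 <= k < n) modulus (F k).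
Proof.
elim: n => [|n IH]; first by rewrite !big_geq // modulus0.
by rewrite !big_nat_recr //= (le_trans (modulusD _ _)) // lerD2r.
Qed.

Lemma cvg_modulus (s : nat -> R[i]) (l : R[i]) :
  (s : nat -> R[i]^o) @ \oo --> (l : R[i]^o) ->
  forall e : R, 0 < e -> \forall n \near \oo, modulus (l - s n) < e.
Proof.
move=> sl e e0; have e0' : 0 < e%:C by rewrite ltcR.
move/cvgrPdist_lt: sl => /(_ _ e0').
by apply: filterS => n; rewrite normr_modulus ltcR.
Qed.

End modulus_theory.

(** * The Cauchy-Riemann equation for power series, without derivatives *)

Section power_series.
Variable R : realType.
Implicit Types (z w h : R[i]) (c : nat -> R[i]).

(** The remainders satisfy [T_(n+1) = (w + h) T_n + n w^(n-1) h^2]. Multiplying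
    by [rho^2] keeps the exponents of [rho] nonnegative. *)
Lemma taylor_monomial (rho : R) w h n :
  modulus w <= rho -> modulus (w + h) <= rho ->
  modulus ((w + h) ^+ n - w ^+ n - n%:R * w ^+ n.-1 * h) * rho ^+ 2
    <= (2 * rho) ^+ n * modulus h ^+ 2.
Proof.
move=> wr whr; have r0 : 0 <= rho by exact: le_trans (modulus_ge0 w) wr.
elim: n => [|n IH].
  by rewrite !expr0 subrr !mul0r subr0 modulus0 mul0r mul1r sqr_ge0.
set T := (X in modulus X) in IH.
have -> : (w + h) ^+ n.+1 - w ^+ n.+1 - n.+1%:R * w ^+ n * h =
    (w + h) * T + n%:R * w ^+ n.-1 * h ^+ 2.
  rewrite /T; case: n {T IH} => [|n] /=; rewrite ?exprS ?expr0 -?natr1; ring.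
have h1 : modulus ((w + h) * T) * rho ^+ 2 <=
    rho * ((2 * rho) ^+ n * modulus h ^+ 2).
  rewrite modulusM -mulrA; apply: ler_pM => //; first exact: modulus_ge0.
  by rewrite mulr_ge0 ?modulus_ge0 ?sqr_ge0.
have h2 : modulus (n%:R * w ^+ n.-1 * h ^+ 2) * rho ^+ 2 <=
    rho * ((2 * rho) ^+ n * modulus h ^+ 2).
  rewrite !modulusM modulus_nat !modulusX.
  have -> : n%:R * modulus w ^+ n.-1 * modulus h ^+ 2 * rho ^+ 2 =
     (n%:R * (modulus w ^+ n.-1 * rho)) * rho * modulus h ^+ 2 by ring.
  have -> : rho * ((2 * rho) ^+ n * modulus h ^+ 2) =
     ((2 * rho) ^+ n) * rho * modulus h ^+ 2 by ring.
  apply: ler_wpM2r; first exact: sqr_ge0.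
  apply: ler_wpM2r => //.
  case: n {T IH h1} => [|n] /=; first by rewrite mul0r expr0.
  rewrite exprMn; apply: ler_pM => //.
  - by rewrite mulr_ge0 ?exprn_ge0 ?modulus_ge0.
  - by rewrite -natrX ler_nat ltnW // ltn_expl.
  - rewrite exprSr; apply: ler_wpM2r => //.
    by apply: lerXn2r => //; rewrite nnegrE // modulus_ge0.
rewrite (le_trans (ler_wpM2r _ (modulusD _ _))) ?sqr_ge0 // mulrDl.
apply: le_trans (lerD h1 h2) _.
by rewrite [_ ^+ n.+1]exprS le_eqVlt; apply/orP; left; apply/eqP; ring.
Qed.

(** The linear terms [n w^(n-1) h] and [i n w^(n-1) (i h)] cancel. *)
Lemma cauchy_riemann_monomial (rho : R) w h n :
  modulus w <= rho -> modulus (w + h) <= rho -> modulus (w + 'i * h) <= rho ->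
  modulus ((w + h) ^+ n - w ^+ n + 'i * ((w + 'i * h) ^+ n - w ^+ n)) *
    rho ^+ 2 <= 2 * (2 * rho) ^+ n * modulus h ^+ 2.
Proof.
move=> wr whr wihr.
have := taylor_monomial n wr whr; set T2 := (X in modulus X * _ <= _) => t2.
have := taylor_monomial n wr wihr; set T1 := (X in modulus X * _ <= _) => t1.
have -> : (w + h) ^+ n - w ^+ n + 'i * ((w + 'i * h) ^+ n - w ^+ n) =
   T2 + 'i * T1.
  have i2 := sqr_i R; rewrite /T1 /T2.
  transitivity ((w + h) ^+ n - w ^+ n + 'i * ((w + 'i * h) ^+ n - w ^+ n)
     - n%:R * w ^+ n.-1 * h * (1 + 'i ^+ 2)); last by ring.
  by rewrite i2 subrr mulr0 subr0.
rewrite (le_trans (ler_wpM2r _ (modulusD _ _))) ?sqr_ge0 // mulrDl.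
apply: le_trans (lerD t2 _) _.
  by rewrite modulusM modulus_i mul1r; exact: t1.
by rewrite modulusM modulus_i mul1r le_eqVlt; apply/orP; left; apply/eqP; ring.
Qed.

Lemma sum_geometric_half n : \sum_(0 <= k < n) 2^-1 ^+ k <= 2 :> R.
Proof.
suff -> : \sum_(0 <= k < n) 2^-1 ^+ k = 2 - 2 * 2^-1 ^+ n :> R.
  by rewrite gerBl mulr_ge0 // exprn_ge0 // invr_ge0.
elim: n => [|n IH]; first by rewrite big_geq // expr0; lra.
by rewrite big_nat_recr //= IH exprSr; field.
Qed.

(** The terms of a convergent series are bounded: from some rank on two partial
    sums differ by at most [2]. *)
Lemma coef_bound c (r : R) (l : R[i]) : 0 <= r ->
  (series (fun n => c n * r%:C ^+ n) : nat -> R[i]^o) @ \oo --> (l : R[i]^o) ->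
  exists2 B : R, 0 <= B & forall n, modulus (c n) * r ^+ n <= B.
Proof.
move=> r0 /cvg_modulus/(_ 1 ltr01)[N _ HN].
pose u n := modulus (c n) * r ^+ n.
have uE n : u n = modulus (c n * r%:C ^+ n).
  by rewrite modulusM modulusX modulusR ger0_norm.
have u0 n : 0 <= u n by rewrite uE modulus_ge0.
exists (2 + \sum_(0 <= k < N) u k).
  by rewrite addr_ge0 // sumr_ge0.
move=> n; rewrite -/(u n); have [nN|Nn] := ltnP n N.
  have : u n <= \sum_(0 <= k < N) u k.
    by rewrite big_mkord (bigD1 (Ordinal nN)) //= lerDl sumr_ge0.
  by move/le_trans; apply; rewrite lerDr.
have := HN n Nn; have := HN n.+1 (leqW Nn).
rewrite /= /series /= big_nat_recr //= => h1 h2.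
suff : u n <= 2.
  by move/le_trans; apply; rewrite lerDl sumr_ge0.
rewrite uE.
set s := \sum_(_ <= _ < _) _ in h1 h2; set v := c n * _ in h1 *.
have -> : v = (l - s) - (l - (s + v)) by ring.
by rewrite (le_trans (modulusB _ _)) //; lra.
Qed.

(** The second estimate is the Cauchy-Riemann equation in the form of a second
    order bound that is uniform in the base point [a + w]; it makes no reference
    to the derivative of [f]. *)
Lemma local_cauchy_riemann (f : R[i] -> R[i]) (a : R[i]) c (e : R) : 0 < e ->
  (forall z, modulus (z - a) < e ->
     (series (fun n => c n * (z - a) ^+ n) : nat -> R[i]^o) @ \oo -->
     (f z : R[i]^o)) ->
  exists rho : R, exists2 M : R, 0 < rho &
    [/\ 0 <= M,
     forall w, modulus w <= rho -> modulus (f (a + w) - f a) <= M * modulus w &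
     forall w h, modulus w <= rho -> modulus (w + h) <= rho ->
       modulus (w + 'i * h) <= rho ->
       modulus (f (a + (w + h)) - f (a + w) +
                'i * (f (a + (w + 'i * h)) - f (a + w))) <= M * modulus h ^+ 2].
Proof.
(* The coefficients are controlled at radius [4 * rho < e], so that
   [|c k| (2 * rho)^k] is dominated by a geometric series of ratio [1/2]. *)
move=> e0 fc; pose rho := e / 8.
have rho0 : 0 < rho by rewrite divr_gt0.
have [||B B0 HB] := @coef_bound c (4 * rho) (f (a + (4 * rho)%:C)).
- by rewrite mulr_ge0 // ltW.
- have aE : a + (4 * rho)%:C - a = (4 * rho)%:C by ring.
  have := fc (a + (4 * rho)%:C); rewrite aE; apply; rewrite modulusR ger0_norm.
    by rewrite /rho; lra.
  by rewrite mulr_ge0 // ltW.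
pose S n w := series (fun n => c n * w ^+ n) n.
have Scvg w : modulus w <= rho -> forall e : R, 0 < e ->
    \forall n \near \oo, modulus (f (a + w) - S n w) < e.
  move=> wr e1 e10; apply: cvg_modulus => //.
  have wE : a + w - a = w by ring.
  have := fc (a + w); rewrite wE; apply.
  by rewrite (le_lt_trans wr) // /rho; lra.
have cB k : modulus (c k) * (2 * rho) ^+ k <= B * 2^-1 ^+ k.
  have -> : 2 * rho = (4 * rho) * 2^-1 by field.
  rewrite exprMn mulrA; apply: ler_wpM2r (HB k).
  by rewrite exprn_ge0 // invr_ge0.
have sumB n : \sum_(0 <= k < n) modulus (c k) * (2 * rho) ^+ k <= 2 * B.
  apply: (@le_trans _ _ (\sum_(0 <= k < n) B * 2^-1 ^+ k)).
    by apply: ler_sum => k _.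
  rewrite -mulr_sumr mulrC; apply: ler_wpM2r => //; exact: sum_geometric_half.
exists rho, (4 * B / rho ^+ 2 + 2 * B / rho) => //; split.
- by rewrite addr_ge0 // divr_ge0 ?mulr_ge0 ?sqr_ge0 // ltW.
- move=> w wr.
  have Sb n : modulus (S n w - S n 0) <= 2 * B / rho * modulus w.
    rewrite /S /series /= -sumrB.
    apply: le_trans (modulus_sum _ _) _.
    apply: (@le_trans _ _ (\sum_(0 <= k < n)
       (modulus (c k) * (2 * rho) ^+ k) * (modulus w / rho))).
      apply: ler_sum => k _; rewrite -mulrBr modulusM -mulrA.
      apply: ler_wpM2l; first exact: modulus_ge0.
      rewrite mulrA ler_pdivlMr //.
      case: k => [|k]; first by rewrite !expr0 subrr modulus0 mul0r mul1r modulus_ge0.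
      rewrite expr0n /= subr0 modulusX exprS exprS.
      have -> : modulus w * modulus w ^+ k * rho = modulus w ^+ k * (modulus w * rho) by ring.
      have -> : 2 * rho * (2 * rho) ^+ k * modulus w =
         (2 * rho) ^+ k * (2 * (modulus w * rho)) by ring.
      have m0 := modulus_ge0 w.
      have mr0 := mulr_ge0 m0 (ltW rho0).
      have wrk : modulus w ^+ k <= (2 * rho) ^+ k.
        by rewrite lerXn2r // ?nnegrE ?mulr_ge0 ?(ltW rho0) //; lra.
      by apply: ler_pM => //; [exact: exprn_ge0|lra].
    have -> : 2 * B / rho * modulus w = (2 * B) * (modulus w / rho) by ring.
    rewrite -mulr_suml; apply: ler_wpM2r (sumB n).
    by rewrite divr_ge0 ?modulus_ge0 // ltW.
  apply: (@le_trans _ _ (2 * B / rho * modulus w)); last first.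
    apply: ler_wpM2r; first exact: modulus_ge0.
    rewrite lerDr; apply: divr_ge0; last exact: sqr_ge0; exact: mulr_ge0.
  apply/ler_addgt0Pr => d d0.
  have d20 : 0 < d / 2 by rewrite divr_gt0.
  have m0 : modulus (0 : R[i]) <= rho by rewrite modulus0 ltW.
  have [N _ HN] : \forall n \near \oo, modulus (f (a + w) - S n w) < d / 2 /\
      modulus (f (a + 0) - S n 0) < d / 2.
    by apply: filterI; apply: Scvg.
  have [h1 h2] := HN N (leqnn N); rewrite addr0 in h2.
  have -> : f (a + w) - f a =
     (S N w - S N 0) + ((f (a + w) - S N w) - (f a - S N 0)) by ring.
  have := modulusD (S N w - S N 0) ((f (a + w) - S N w) - (f a - S N 0)).
  have := modulusB (f (a + w) - S N w) (f a - S N 0).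
  by have := Sb N; lra.
- move=> w h wr whr wihr.
  have Sb n : modulus (S n (w + h) - S n w + 'i * (S n (w + 'i * h) - S n w)) <=
       4 * B / rho ^+ 2 * modulus h ^+ 2.
    rewrite /S /series /= -!sumrB mulr_sumr -big_split /=.
    apply: le_trans (modulus_sum _ _) _.
    apply: (@le_trans _ _ (\sum_(0 <= k < n)
       (modulus (c k) * (2 * rho) ^+ k) * (2 * modulus h ^+ 2 / rho ^+ 2))).
      apply: ler_sum => k _.
      have -> : c k * (w + h) ^+ k - c k * w ^+ k +
          'i * (c k * (w + 'i * h) ^+ k - c k * w ^+ k) =
        c k * ((w + h) ^+ k - w ^+ k + 'i * ((w + 'i * h) ^+ k - w ^+ k)) by ring.
      rewrite modulusM -mulrA; apply: ler_wpM2l; first exact: modulus_ge0.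
      rewrite mulrA ler_pdivlMr ?exprn_gt0 //.
      apply: le_trans (cauchy_riemann_monomial k wr whr wihr) _.
      by rewrite le_eqVlt; apply/orP; left; apply/eqP; ring.
    rewrite -mulr_suml.
    have -> : 4 * B / rho ^+ 2 * modulus h ^+ 2 =
       (2 * B) * (2 * modulus h ^+ 2 / rho ^+ 2) by ring.
    apply: ler_wpM2r (sumB n).
    by apply: divr_ge0; [apply: mulr_ge0 => //|]; exact: sqr_ge0.
  apply: (@le_trans _ _ (4 * B / rho ^+ 2 * modulus h ^+ 2)); last first.
    apply: ler_wpM2r; first exact: sqr_ge0.
    by rewrite lerDl; apply: divr_ge0; [exact: mulr_ge0|exact: ltW].
  apply/ler_addgt0Pr => d d0.
  have d20 : 0 < d / 4 by rewrite divr_gt0.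
  have [N _ HN] : \forall n \near \oo, modulus (f (a + w) - S n w) < d / 4 /\
      (modulus (f (a + (w + h)) - S n (w + h)) < d / 4 /\
       modulus (f (a + (w + 'i * h)) - S n (w + 'i * h)) < d / 4).
    by apply: filterI; last apply: filterI; apply: Scvg.
  have [h1 [h2 h3]] := HN N (leqnn N).
  set d1 := f (a + w) - _ in h1; set d2 := f (a + (w + h)) - _ in h2.
  set d3 := f (a + (w + 'i * h)) - _ in h3.
  have -> : f (a + (w + h)) - f (a + w) + 'i * (f (a + (w + 'i * h)) - f (a + w)) =
     (S N (w + h) - S N w + 'i * (S N (w + 'i * h) - S N w)) +
     ((d2 - d1) + 'i * (d3 - d1)) by rewrite /d1 /d2 /d3; ring.
  apply: le_trans (modulusD _ _) _; apply: lerD (Sb N) _.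
  apply: le_trans (modulusD _ _) _; rewrite modulusM modulus_i mul1r.
  have := modulusB d2 d1; have := modulusB d3 d1; lra.
Qed.

End power_series.

(** * Uniform estimates on closed discs *)

Section compactness.
Variable R : realType.
Implicit Types (z w h a b : R[i]) (f : R[i] -> R[i]).

Lemma Re_le_modulus z : `|complex.Re z| <= modulus z.
Proof.
case: z => x y /=; rewrite -[leLHS]sqrtr_sqr ler_sqrt ?addr_ge0 ?sqr_ge0 //.
by rewrite lerDl sqr_ge0.
Qed.

Lemma Im_le_modulus z : `|complex.Im z| <= modulus z.
Proof.
case: z => x y /=; rewrite -[leLHS]sqrtr_sqr ler_sqrt ?addr_ge0 ?sqr_ge0 //.
by rewrite lerDr sqr_ge0.
Qed.

Lemma modulus_le_ReIm z : modulus z <= `|complex.Re z| + `|complex.Im z|.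
Proof.
case: z => x y /=; rewrite -[leRHS]ger0_norm ?addr_ge0 // -[leRHS]sqrtr_sqr.
rewrite ler_sqrt ?sqr_ge0 // sqrrD !real_normK ?num_real //.
by rewrite -addrA [X in _ <= _ + X]addrC addrA lerDl mulrn_wge0 // mulr_ge0.
Qed.

(** Compactness of closed discs, for properties [P n] that hold near every point
    from some rank [n] on. *)
Lemma closed_disc_uniform (rho : R) (P : nat -> R[i] -> Prop) :
  (forall a, modulus a <= rho -> exists2 d : R, 0 < d &
     exists n0, forall n b, (n0 <= n)%N -> modulus (b - a) < d -> P n b) ->
  exists n, forall a, modulus a <= rho -> P n a.
Proof.
move=> locP.
pose Q n (x : R * R) := modulus (x.1 +i* x.2) <= rho -> P n (x.1 +i* x.2).
have cK : compact (`[- rho, rho]%classic `*` `[- rho, rho]%classic : set (R * R)).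
  by apply: compact_setX; exact: segment_compact.
have /compact_near_coveringP/(_ _ \oo Q _) := cK.
have dE (x y : R * R) : modulus (y.1 +i* y.2 - (x.1 +i* x.2)) <=
    `|x.1 - y.1| + `|x.2 - y.2|.
  by rewrite modulusBC; exact: modulus_le_ReIm.
case.
  move=> x _; have [xr|xr] := leP (modulus (x.1 +i* x.2)) rho.
    have [d d0 [n0 Hd]] := locP _ xr.
    have d20 : 0 < d / 2 by rewrite divr_gt0.
    exists (ball x (d / 2), [set n | (n0 <= n)%N]).
      split => /=; first exact: nbhsx_ballx.
      by exists n0.
    move=> [y n] /= [[y1 y2] n0n] _; apply: Hd => //.
    apply: le_lt_trans (dE _ _) _.
    rewrite (_ : d = d / 2 + d / 2); last by field.
    exact: ltrD y1 y2.
  pose d := (modulus (x.1 +i* x.2) - rho) / 2.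
  have d0 : 0 < d by rewrite divr_gt0 // subr_gt0.
  exists (ball x d, setT).
    split => /=; first exact: nbhsx_ballx.
    exact: filterT.
  move=> [y n] /= [[y1 y2] _] yr; exfalso.
  have := modulusB (y.1 +i* y.2) (y.1 +i* y.2 - (x.1 +i* x.2)).
  have -> : y.1 +i* y.2 - (y.1 +i* y.2 - (x.1 +i* x.2)) = x.1 +i* x.2 by ring.
  have := dE x y; move: y1 y2 yr; rewrite /d /ball /= /d; lra.
move=> N _ HN; exists N => -[x y] xyr.
apply: (HN N (leqnn N) (x, y)) => //=.
have := Re_le_modulus (x +i* y); have := Im_le_modulus (x +i* y).
move=> /= hy hx; split; rewrite /= in_itv /= -ler_norml.
  exact: le_trans xyr.
exact: le_trans xyr.
Qed.

Lemma analytic_bounded f (rho : R) : analytic_on_disc f -> rho < 1 ->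
  exists2 B : R, 0 <= B & forall a, modulus a <= rho -> modulus (f a) <= B.
Proof.
move=> fa r1.
have [a ar|n Hn] := @closed_disc_uniform rho (fun n a => modulus (f a) <= n%:R);
    last by exists n%:R.
have ad : disc a by exact: le_lt_trans ar r1.
have [c [e [e0 fc]]] := fa _ ad.
have [r [M r0 [M0 Lf _]]] := local_cauchy_riemann e0 fc.
exists r => //; pose X := modulus (f a) + M * r.
have X0 : 0 <= X by rewrite addr_ge0 ?modulus_ge0 ?mulr_ge0 // ltW.
exists (Num.bound X) => n b Xn br.
apply: (@le_trans _ _ X); last first.
  by apply/ltW/(lt_le_trans (archi_boundP X0)); rewrite ler_nat.
have -> : f b = f a + (f (a + (b - a)) - f a) by rewrite (addrC a) subrK; ring.
rewrite (le_trans (modulusD _ _)) // lerD2l.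
apply: le_trans (Lf _ (ltW br)) _; apply: ler_wpM2l => //; exact: ltW.
Qed.

Lemma cauchy_riemann_uniform f (rho : R) : analytic_on_disc f -> rho < 1 ->
  exists M : R, exists2 eta : R, 0 < eta &
    0 <= M /\ forall a h, modulus a <= rho -> modulus h <= eta ->
    modulus (f (a + h) - f a + 'i * (f (a + 'i * h) - f a)) <= M * modulus h ^+ 2.
Proof.
move=> fa r1.
pose P n a := forall h, modulus h <= n.+1%:R^-1 ->
  modulus (f (a + h) - f a + 'i * (f (a + 'i * h) - f a)) <= n%:R * modulus h ^+ 2.
have [a ar|n Hn] := @closed_disc_uniform rho P; last first.
  by exists n%:R, n.+1%:R^-1; rewrite ?invr_gt0 ?ltr0n //; split => // a h /Hn; apply.
have ad : disc a by exact: le_lt_trans ar r1.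
have [c [e [e0 fc]]] := fa _ ad.
have [r [M r0 [M0 _ Lf]]] := local_cauchy_riemann e0 fc.
have r20 : 0 < r / 2 by rewrite divr_gt0.
exists (r / 2) => //.
exists (maxn (Num.bound M) (Num.bound (r / 2)^-1)) => n b.
rewrite geq_max => /andP[n1 n2] br h hn.
have hr : modulus h <= r / 2.
  apply: le_trans hn _; rewrite -[leRHS]invrK lef_pV2 ?posrE ?invr_gt0 ?ltr0n //.
  apply/ltW/(lt_le_trans (archi_boundP _)); first by rewrite invr_ge0 ltW.
  by rewrite ler_nat (leq_trans n2).
have bE v : a + (b - a + v) = b + v by ring.
have bE0 : a + (b - a) = b by ring.
have := Lf (b - a) h; rewrite !bE bE0 => Lb.
apply: le_trans (Lb _ _ _) _.
- by apply: ltW; apply: lt_le_trans br _; lra.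
- have := modulusD (b - a) h; lra.
- by have := modulusD (b - a) ('i * h); rewrite modulusM modulus_i mul1r; lra.
apply: ler_wpM2r; first exact: sqr_ge0.
by apply/ltW/(lt_le_trans (archi_boundP M0)); rewrite ler_nat.
Qed.

End compactness.

(** * The mean value property over roots of unity *)

Section mean_value.
Variable R : realType.
Implicit Types (z w h a b : R[i]) (f : R[i] -> R[i]).

Definition cis (t : R) : R[i] := cos t +i* sin t.

Lemma modulus_cis t : modulus (cis t) = 1.
Proof. by rewrite /= cos2Dsin2 sqrtr1. Qed.

Lemma cisD s t : cis (s + t) = cis s * cis t.
Proof.
by apply/eqP; rewrite eq_complex /= cosD sinD /= [sin s * _ + _]addrC eqxx eqxx.
Qed.

Lemma cisX t n : cis t ^+ n = cis (t * n%:R).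
Proof.
elim: n => [|n IH]; first by rewrite mulr0 /cis cos0 sin0 expr0.
by rewrite exprS IH -cisD mulrS mulrDr mulr1.
Qed.

Lemma cis_root n : cis (2 * pi / n.+1%:R) ^+ n.+1 = 1.
Proof.
rewrite cisX divfK ?pnatr_eq0 // mulr_natl.
by rewrite /cis cos2pi sin2pi.
Qed.

(** The last inequality measures how fast the spiral of ratio
    [tau = 1 - i (w - 1)] expands: with [w = cos t + i sin t] and [d = |w - 1|],
    [|tau|^2 = 1 + 2 sin t + d^2], and [d <= 2 sin t] as soon as
    [cos t >= 0]. *)
Lemma small_root_of_unity (eta : R) : 0 < eta -> exists n, exists w : R[i],
  [/\ modulus w = 1, w ^+ n.+1 = 1, 0 < modulus (w - 1) <= eta &
   1 + modulus (w - 1) <= modulus (1 - 'i * (w - 1)) ^+ 2].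
Proof.
move=> eta0.
(* [d^2 = 2 - 2 cos t], so [1 - cos t < eta^2 / 2] means [d < eta]. *)
pose m := Num.min 1 (eta ^+ 2 / 2).
have m0 : 0 < m by rewrite lt_min ltr01 divr_gt0 // exprn_gt0.
have /nbhs_ballP[e /= e0 He] : \forall x \near (0 : R), `|cos (0 : R) - cos x| < m.
  move: (@continuous_cos R 0) => /cvgrPdist_lt; exact.
have pi0 := pi_gt0 R.
(* The order exceeds [4] for the angle to be less than [pi / 2]. *)
pose X := 2 * pi / e + 4.
have X0 : 0 <= X by rewrite addr_ge0 // divr_ge0 ?mulr_ge0 // ltW.
pose n := Num.bound X; pose t : R := 2 * pi / n.+1%:R.
have nX : X < n.+1%:R by apply: lt_trans (archi_boundP X0) _; rewrite ltr_nat.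
have n0 : 0 < n.+1%:R :> R by rewrite ltr0n.
have t0 : 0 < t by rewrite divr_gt0 // mulr_gt0.
have te : t < e.
  rewrite /t ltr_pdivrMr // -ltr_pdivrMl // [_^-1 * _]mulrC.
  by apply: lt_trans nX; rewrite /X ltrDl.
have tpi : t < pi / 2.
  rewrite /t ltr_pdivrMr //.
  have : 4 < n.+1%:R :> R.
    by apply: le_lt_trans nX; rewrite /X lerDr divr_ge0 ?mulr_ge0 // ltW.
  by move=> n4; nra.
have cm : 1 - cos t < m.
  have := He t; rewrite /ball /= sub0r normrN gtr0_norm // cos0 => /(_ te).
  by apply: le_lt_trans; exact: ler_norm.
have sin0 : 0 < sin t by apply: sin_gt0_pi; rewrite t0 /=; lra.
have cos0 : 0 < cos t by move: cm; rewrite lt_min => /andP[]; lra.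
have cs := cos2Dsin2 t.
pose d := modulus (cis t - 1).
have d2 : d ^+ 2 = 2 - 2 * cos t.
  rewrite /d /= subr0 sqr_sqrtr ?addr_ge0 ?sqr_ge0 //; nra.
have d0 : 0 <= d by exact: modulus_ge0.
have cos1 : cos t < 1 by nra.
have dgt0 : 0 < d by rewrite lt_neqAle d0 andbT eq_sym; apply/eqP => dd; nra.
have ds : d <= 2 * sin t by nra.
exists n, (cis t); split.
- exact: modulus_cis.
- exact: cis_root.
- rewrite -/d dgt0 /=; move: cm; rewrite lt_min => /andP[_ cm]; nra.
- have -> : modulus (1 - 'i * (cis t - 1)) ^+ 2 = 1 + 2 * sin t + d ^+ 2.
    rewrite d2 /= sqr_sqrtr ?addr_ge0 ?sqr_ge0 //; nra.
  by rewrite -/d; nra.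
Qed.


Section cyclic_sum.
Variables (f : R[i] -> R[i]) (z omega : R[i]) (n : nat).

Definition cyclic_sum (w : R[i]) : R[i] :=
  \sum_(0 <= k < n.+1) f (z + w * omega ^+ k).

Lemma cyclic_sum_rotate w : omega ^+ n.+1 = 1 ->
  cyclic_sum (w * omega) = cyclic_sum w.
Proof.
move=> wn; rewrite /cyclic_sum big_nat_recr //= [RHS]big_nat_recl //= addrC.
rewrite -mulrA -exprS wn expr0; congr (_ + _); apply: eq_bigr => k _.
by rewrite -mulrA -exprS.
Qed.

(** Going from [w] to [w tau], with [tau - 1 = - i (omega - 1)], changes the sum
    as much as [- i] times the rotation by [omega] does, up to second order; and
    the rotation does not change it. *)
Lemma cyclic_sum_step (M eta rho : R) w :
  (forall a h, modulus a <= rho -> modulus h <= eta ->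
    modulus (f (a + h) - f a + 'i * (f (a + 'i * h) - f a)) <= M * modulus h ^+ 2) ->
  modulus omega = 1 -> omega ^+ n.+1 = 1 -> modulus (omega - 1) <= eta ->
  modulus z + modulus w <= rho -> modulus w <= 1 ->
  modulus (cyclic_sum (w * (1 - 'i * (omega - 1))) - cyclic_sum w) <=
    n.+1%:R * (M * modulus (omega - 1) ^+ 2 * modulus w ^+ 2).
Proof.
move=> CR mo1 om1 oe zw w1.
pose h k := w * omega ^+ k * (- 'i * (omega - 1)).
have ii : 'i * 'i = -1 :> R[i] by rewrite -expr2 sqr_i.
have mh k : modulus (h k) = modulus w * modulus (omega - 1).
  by rewrite /h !modulusM modulusX modulusN modulus_i mo1 expr1n mulr1 mul1r.
have -> : cyclic_sum (w * (1 - 'i * (omega - 1))) - cyclic_sum w =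
    \sum_(0 <= k < n.+1)
      (f (z + w * omega ^+ k + h k) - f (z + w * omega ^+ k) +
       'i * (f (z + w * omega ^+ k + 'i * h k) - f (z + w * omega ^+ k))).
  rewrite big_split -mulr_sumr !sumrB /=.
  have -> : \sum_(0 <= k < n.+1) f (z + w * omega ^+ k + 'i * h k) =
      cyclic_sum (w * omega).
    apply: eq_bigr => k _; congr f; rewrite /h.
    have -> : 'i * (w * omega ^+ k * (- 'i * (omega - 1))) =
       w * omega ^+ k * (- ('i * 'i) * (omega - 1)) by ring.
    by rewrite ii; ring.
  rewrite cyclic_sum_rotate // subrr mulr0 addr0; congr (_ - _).
  by apply: eq_bigr => k _; congr f; rewrite /h; ring.
apply: le_trans (modulus_sum _ _) _.
rewrite mulr_natl -[n.+1 in leRHS]subn0 -[leRHS]sumr_const_nat.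
apply: ler_sum => k _.
have -> : M * modulus (omega - 1) ^+ 2 * modulus w ^+ 2 = M * modulus (h k) ^+ 2.
  by rewrite mh; ring.
apply: CR.
  apply: le_trans (modulusD _ _) _.
  by rewrite modulusM modulusX mo1 expr1n mulr1.
rewrite mh; apply: le_trans oe.
by apply: ler_piMl => //; exact: modulus_ge0.
Qed.

End cyclic_sum.

Lemma exists_expr_lt (q e : R) : 0 <= q < 1 -> 0 < e -> exists n, q ^+ n < e.
Proof.
move=> /andP[q0 q1] e0.
have /cvgrPdist_lt/(_ _ e0)[n _ Hn] : q ^+ n @[n --> \oo] --> (0 : R).
  by apply: cvg_expr; rewrite ger0_norm.
exists n; have := Hn n (leqnn n).
by rewrite /= sub0r normrN ger0_norm // exprn_ge0.
Qed.

(** The errors committed along the spiral [v j = w / tau^j] form a geometric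
    series: [|v j|^2 <= (1 + d)^(- j)], so that
    [M d^2 (|v 1|^2 + |v 2|^2 + ...) <= M d]; and [v j] tends to [0], where the
    continuity of [f] at [z] takes over. *)
Lemma mean_value f z (delta eps : R) : analytic_on_disc f ->
  0 <= delta -> modulus z + delta < 1 -> 0 < eps ->
  exists n, exists2 omega, modulus omega = 1 & forall w, modulus w <= delta ->
    modulus (cyclic_sum f z omega n w - n.+1%:R * f z) <= n.+1%:R * eps.
Proof.
move=> fa d0 zd e0.
have [M [eta eta0 [M0 CR]]] := cauchy_riemann_uniform fa zd.
(* [d <= eps / (M + 1)] leaves the share [eps / (M + 1)] of [eps] to the
   continuity of [f] at [z]. *)
pose eta' := Num.min eta (eps / (M + 1)).
have M10 : 0 < M + 1 by rewrite ltr_wpDl.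
have eta'0 : 0 < eta' by rewrite lt_min eta0 divr_gt0.
have [n [omega [mo1 om1 /andP[ o0 oe] tau2]]] := small_root_of_unity eta'0.
move: (oe); rewrite le_min => /andP[oeta oeps].
exists n, omega => // w wd.
set tau := 1 - 'i * (omega - 1) in tau2.
set d := modulus (omega - 1) in o0 oe oeta oeps tau2.
have m0 := modulus_ge0 z.
have tau1 : 1 < modulus tau.
  have := modulus_ge0 tau; rewrite leNgt => t0; rewrite ltNge; apply/negP => t1.
  by have : modulus tau ^+ 2 <= 1; [rewrite expr_le1 // leNgt|lra].
have tau0 : tau != 0.
  by apply/eqP => te; move: tau1; rewrite te modulus0; lra.
have d1 : 0 < 1 + d by lra.
pose q := (1 + d)^-1.
have q0 : 0 < q by rewrite invr_gt0.
have qE : q * (1 + d) = 1 by rewrite mulVf // gt_eqF.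
have qJ J : 0 < q ^+ J by rewrite exprn_gt0.
pose v J := w * tau ^- J.
have vd J : modulus (v J) ^+ 2 <= q ^+ J.
  rewrite /v modulusM modulusV modulusX exprMn -[leRHS]mul1r.
  apply: ler_pM; rewrite ?sqr_ge0 //.
    by rewrite expr_le1 ?modulus_ge0 //; lra.
  rewrite -exprVn -exprM mulnC exprM; apply: lerXn2r.
  - by rewrite nnegrE sqr_ge0.
  - by rewrite nnegrE ltW.
  - by rewrite exprVn lef_pV2 ?posrE // exprn_gt0 // (lt_trans _ tau1).
have vw J : modulus (v J) <= modulus w.
  rewrite /v modulusM modulusV modulusX ler_piMr ?modulus_ge0 //.
  by rewrite invf_le1 ?exprn_ege1 ?exprn_gt0 ?(lt_trans _ tau1) // ltW.
pose F := cyclic_sum f z omega n.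
have n0 : 0 < n.+1%:R :> R by rewrite ltr0n.
have vS J : v J = v J.+1 * tau.
  by rewrite /v exprSr invfM -!mulrA mulVf // mulr1.
have tele J : modulus (F w - F (v J)) <= n.+1%:R * (M * d * (1 - q ^+ J)).
  elim: J => [|J IH].
    by rewrite /v expr0 invr1 mulr1 !subrr modulus0 !mulr0.
  have := @cyclic_sum_step f z omega n M eta (modulus z + delta) (v J.+1)
    CR mo1 om1 oeta.
  rewrite -/tau -vS -/F -/d => /(_ _ _)/le_trans step.
  have -> : F w - F (v J.+1) = (F w - F (v J)) + (F (v J) - F (v J.+1)) by ring.
  apply: le_trans (modulusD _ _) _.
  have -> : n.+1%:R * (M * d * (1 - q ^+ J.+1)) = n.+1%:R * (M * d * (1 - q ^+ J))
      + n.+1%:R * (M * d ^+ 2 * q ^+ J.+1).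
    have -> : q ^+ J = q ^+ J * (q * (1 + d)) by rewrite qE mulr1.
    by rewrite exprS; ring.
  apply: lerD IH _; apply: step.
  - by rewrite lerD2l (le_trans (vw _)).
  - by rewrite (le_trans (vw _)) // (le_trans wd) //; lra.
  rewrite ler_pM2l //; apply: ler_wpM2l (vd _).
  by rewrite mulr_ge0 // sqr_ge0.
have Md : M * d <= eps * (M / (M + 1)).
  have -> : eps * (M / (M + 1)) = M * (eps / (M + 1)) by ring.
  exact: ler_wpM2l.
have zdisc : disc z by rewrite /disc /=; lra.
have [c [e [e00 fc]]] := fa _ zdisc.
have [r [M' r0 [M'0 Lf _]]] := local_cauchy_riemann e00 fc.
pose s := Num.min r (eps / (M + 1) / (M' + 1)).
have M'10 : 0 < M' + 1 by rewrite ltr_wpDl.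
have s0 : 0 < s by rewrite lt_min r0 !divr_gt0.
have [|J HJ] := @exists_expr_lt q (s ^+ 2) _ (exprn_gt0 _ s0).
  by rewrite ltW //= invf_lt1 //; lra.
have vs : modulus (v J) <= s.
  have := le_lt_trans (vd J) HJ; by rewrite ltr_pXn2r ?nnegrE ?modulus_ge0 ?(ltW s0) //; exact: ltW.
move: (vs); rewrite le_min => /andP[vr ve].
have Fv : modulus (F (v J) - n.+1%:R * f z) <= n.+1%:R * (eps / (M + 1)).
  have -> : F (v J) - n.+1%:R * f z =
      \sum_(0 <= k < n.+1) (f (z + v J * omega ^+ k) - f z).
    by rewrite sumrB sumr_const_nat subn0 mulr_natl.
  apply: le_trans (modulus_sum _ _) _.
  rewrite mulr_natl -[n.+1 in leRHS]subn0 -[leRHS]sumr_const_nat.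
  apply: ler_sum => k _.
  have mv : modulus (v J * omega ^+ k) = modulus (v J).
    by rewrite modulusM modulusX mo1 expr1n mulr1.
  apply: le_trans (Lf _ _) _; rewrite mv //.
  apply: (@le_trans _ _ ((M' + 1) * modulus (v J))).
    by apply: ler_wpM2r; [exact: modulus_ge0|rewrite lerDl].
  by rewrite mulrC -ler_pdivlMr.
have -> : F w - n.+1%:R * f z = (F w - F (v J)) + (F (v J) - n.+1%:R * f z) by ring.
apply: le_trans (modulusD _ _) _; apply: le_trans (lerD (tele J) Fv) _.
rewrite -mulrDr ler_pM2l //.
have -> : eps = eps * (M / (M + 1)) + eps / (M + 1) by field; rewrite gt_eqF.
rewrite [X in _ + X <= _](_ : _ = eps / (M + 1)); last by field; rewrite gt_eqF.
rewrite lerD2r (le_trans _ Md) // ler_piMr ?mulr_ge0 // ?(ltW o0) //.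
by rewrite gerBl ltW.
Qed.

End mean_value.

(** * Translations, shears and rotations *)

Section translation.
Variable R : realType.
Local Notation mu := (@lebesgue_measure R).
Local Open Scope ereal_scope.

Lemma measurable_translation (s : R) :
  measurable_fun [set: measurableTypeR R] (fun t => t + s : measurableTypeR R)%R.
Proof. by apply: measurable_funD => //; exact: measurable_id. Qed.

Lemma lebesgue_measure_translation (s : R) (A : set R) : measurable A ->
  pushforward mu (fun t => t + s : measurableTypeR R)%R A = mu A.
Proof.
move=> mA; have mt := measurable_translation s.
apply/esym/lebesgue_measure_unique => //= _ [[a b]] _ <-.
rewrite /pushforward.
have -> : (fun t => t + s : measurableTypeR R)%R @^-1` `]a, b]%classic =
    `](a - s)%R, (b - s)%R]%classic.
  by apply/seteqP; split => t /=; rewrite !in_itv /= ltrBlDr lerBrDr.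
rewrite !lebesgue_measure_itv /= !lte_fin ltrD2r.
by case: ifPn => // _; rewrite -!EFinB; congr (_%:E); ring.
Qed.

Lemma ge0_integral_translation (s : R) (D : set R) (g : R -> \bar R) :
  measurable D -> measurable_fun D g -> (forall t, D t -> 0 <= g t) ->
  \int[mu]_(t in (fun t => t + s)%R @^-1` D) g (t + s)%R = \int[mu]_(t in D) g t.
Proof.
move=> mD mg g0.
rewrite -(@ge0_integral_pushforward _ _ _ _ R _ (measurable_translation s) mu D g) //.
  apply: eq_measure_integral; first exact: measurable_translation.
  by move=> mt A mA _; exact: lebesgue_measure_translation.
by move=> t; rewrite inE; exact: g0.
Qed.

(** The part of the interval from [s] to [T + s] that lies beyond [T] is moved
    back to the interval from [0] to [s]. *)
Lemma ge0_integral_periodic (T s : R) (g : R -> \bar R) :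
  measurable_fun setT g -> (forall t, 0 <= g t) ->
  (forall t, g (t + T)%R = g t) -> (0 <= s <= T)%R ->
  \int[mu]_(t in `[0%R, T]) g (t + s)%R = \int[mu]_(t in `[0%R, T]) g t.
Proof.
move=> mg g0 gT /andP[s0 sT].
have mgS (D : set R) : measurable_fun D g by exact: measurable_funTS.
rewrite [in LHS](_ : `[0%R, T]%classic = (fun t => t + s)%R @^-1` `[s, (T + s)%R]%classic); last first.
  apply/seteqP; split => t /=; rewrite !in_itv /=; lra.
rewrite ge0_integral_translation //.
rewrite (_ : `[s, (T + s)%R]%classic = `[s, T]%classic `|` `]T, (T + s)%R]%classic); last first.
  apply/seteqP; split => t /=; rewrite !in_itv /=; last by move=> []; lra.
  by move=> st; have [tT|tT] := leP t T; [left|right]; lra.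
rewrite ge0_integral_setU //; [|exact: mgS|]; last first.
  by rewrite disj_set2E; apply/eqP/seteqP; split => // t /= []; rewrite !in_itv /=; lra.
have -> : \int[mu]_(t in `[0%R, T]) g t =
    \int[mu]_(t in `[s, T]) g t + \int[mu]_(t in `[0%R, s[) g t.
  rewrite -ge0_integral_setU //; [|exact: mgS|]; last first.
    by rewrite disj_set2E; apply/eqP/seteqP; split => // t /= []; rewrite !in_itv /=; lra.
  congr (integral _ _ _); apply/seteqP; split => t /=; rewrite !in_itv /=; last by move=> []; lra.
  by move=> st; have [tT|tT] := leP s t; [left|right]; lra.
congr (_ + _).
rewrite -(@ge0_integral_translation T `]T, (T + s)%R]%classic) //.
rewrite (_ : _ @^-1` _ = `]0%R, s]%classic); last first.
  apply/seteqP; split => t /=; rewrite !in_itv /=; lra.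
under eq_integral do rewrite gT.
by rewrite integral_itv_obnd_cbnd // integral_itv_bndo_bndc.
Qed.

End translation.

Section planar_invariance.
Variable R : realType.
Local Notation mu := (@lebesgue_measure R).
Local Notation plane := (measurableTypeR R * measurableTypeR R)%type.
Local Notation mu2 := (mu \x mu)%E.
Local Open Scope ereal_scope.

(** Invariance of integrals rather than of the measure of sets, so that
    composition is immediate. *)
Definition area_preserving (phi : plane -> plane) :=
  measurable_fun setT phi /\
  forall h : plane -> \bar R, measurable_fun setT h -> (forall x, 0 <= h x) ->
  \int[mu2]_x h (phi x) = \int[mu2]_x h x.

Lemma area_preserving_comp phi psi :
  area_preserving phi -> area_preserving psi -> area_preserving (phi \o psi).
Proof.
move=> [mphi phiE] [mpsi psiE]; split; first exact: measurableT_comp.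
move=> h mh h0; rewrite -(phiE h) // -(psiE (h \o phi)) //; last by move=> x /=; exact: h0.
exact: measurableT_comp.
Qed.

Lemma area_preserving_shear2 (u : R -> R) : measurable_fun setT u ->
  area_preserving (fun x : plane => (x.1, x.2 + u x.1)%R).
Proof.
move=> mu'.
have mphi : measurable_fun setT (fun x : plane => (x.1, x.2 + u x.1)%R : plane).
  apply: measurable_fun_pair; first exact: measurable_fst.
  apply: measurable_funD; first exact: measurable_snd.
  exact: measurableT_comp measurable_fst.
split => // h mh h0.
rewrite (fubini_tonelli1 (fun x : plane => h (x.1, x.2 + u x.1)%R)) //;
  last exact: measurableT_comp.
rewrite fubini_tonelli1 //; apply: eq_integral => x _; rewrite /fubini_F /=.
rewrite -(@ge0_integral_translation _ (u x) setT (fun y => h (x, y))) //.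
exact: measurableT_comp (pair1_measurable _).
Qed.

Lemma area_preserving_shear1 (u : R -> R) : measurable_fun setT u ->
  area_preserving (fun x : plane => (x.1 + u x.2, x.2)%R).
Proof.
move=> mu'.
have mphi : measurable_fun setT (fun x : plane => (x.1 + u x.2, x.2)%R : plane).
  apply: measurable_fun_pair; last exact: measurable_snd.
  apply: measurable_funD; first exact: measurable_fst.
  exact: measurableT_comp measurable_snd.
split => // h mh h0.
rewrite (fubini_tonelli2 (fun x : plane => h (x.1 + u x.2, x.2)%R)) //;
  last exact: measurableT_comp.
rewrite fubini_tonelli2 //; apply: eq_integral => y _; rewrite /fubini_G /=.
rewrite -(@ge0_integral_translation _ (u y) setT (fun x => h (x, y))) //.
exact: measurableT_comp (pair2_measurable _).
Qed.

Lemma area_preserving_translation (a b : R) :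
  area_preserving (fun x : plane => (x.1 + a, x.2 + b)%R).
Proof.
exact: area_preserving_comp (@area_preserving_shear1 (cst a) _)
  (@area_preserving_shear2 (cst b) _).
Qed.

Definition rotation (c s : R) (x : plane) : plane :=
  (c * x.1 - s * x.2, s * x.1 + c * x.2)%R.

(** A rotation by an angle [t] that is not a multiple of [pi] is a product of
    three shears, of slopes [- tan (t / 2)], [sin t] and [- tan (t / 2)]; the
    half turn is the square of a quarter turn. *)
Lemma area_preserving_rotation (c s : R) : (c ^+ 2 + s ^+ 2 = 1)%R ->
  area_preserving (rotation c s).
Proof.
have mlin (a : R) : measurable_fun [set: measurableTypeR R] (fun t : R => a * t : R)%R.
  exact: mulrl_measurable.
have rot (c' s' : R) : (c' ^+ 2 + s' ^+ 2 = 1)%R -> s' != 0%R ->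
    area_preserving (rotation c' s').
  move=> cs s0; pose a := ((c' - 1) / s')%R.
  have sa := area_preserving_shear1 (mlin a).
  have ss := area_preserving_shear2 (mlin s').
  have := area_preserving_comp sa (area_preserving_comp ss sa).
  congr (area_preserving _); apply/funext => x; rewrite /rotation /= /a.
  have s2 : (s' ^+ 2 = (1 - c') * (1 + c'))%R by lra.
  have sv : (s' * s'^-1 = 1)%R by rewrite divff.
  congr (_, _); last by field.
  transitivity (c' * x.1 + (c' - 1) * (1 + c') / s' * x.2)%R; first by field.
  have -> : ((c' - 1) * (1 + c') = - s' ^+ 2)%R by rewrite s2; ring.
  by field.
move=> cs; have [s0|] := eqVneq s 0%R; last exact: rot.
have r1 : area_preserving (rotation 0 1).
  by apply: rot; [ring|exact: oner_neq0].
have c2 : (c ^+ 2 == 1)%R by rewrite -cs s0 expr0n /= addr0.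
move: c2; rewrite sqrf_eq1 s0 => /orP[]/eqP->.
  rewrite (_ : rotation _ _ = id); first by split.
  by apply/funext => -[x y]; rewrite /rotation /=; congr (_, _); ring.
have := area_preserving_comp r1 r1; congr (area_preserving _).
by apply/funext => -[x y]; rewrite /rotation /=; congr (_, _); ring.
Qed.

End planar_invariance.

(** * Area integrals and circular means *)

Section polar_coordinates.
Variable R : realType.
Local Notation mu := (@lebesgue_measure R).
Local Notation plane := (measurableTypeR R * measurableTypeR R)%type.
Local Notation mu2 := (mu \x mu)%E.

Lemma polar_form (x : plane) :
  exists2 s : R, 0 <= s <= 2 * pi &
  x = (modulus (cplx x) * cos s, modulus (cplx x) * sin s).
Proof.
have pi0 := pi_ge0 R.
case: x => a b; rewrite /cplx /=; set r := Num.sqrt _.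
have r2 : r ^+ 2 = a ^+ 2 + b ^+ 2 by rewrite sqr_sqrtr // addr_ge0 ?sqr_ge0.
have r0 : 0 <= r by exact: sqrtr_ge0.
clearbody r; have [rz|rn] := eqVneq r 0.
  exists 0; first by rewrite lexx mulr_ge0.
  rewrite rz !mul0r; move: r2; rewrite rz expr0n /= => /esym/eqP.
  by rewrite paddr_eq0 ?sqr_ge0 // !sqrf_eq0 => /andP[/eqP-> /eqP->].
have rp : 0 < r by rewrite lt_neqAle eq_sym rn.
pose c := a / r.
have ca : a = r * c by rewrite /c mulrC divfK.
have c2 : (r * c) ^+ 2 + b ^+ 2 = r ^+ 2 by rewrite -ca r2.
have c1 : -1 <= c <= 1.
  rewrite -ler_norml -(@expr_le1 _ 2) // real_normK ?num_real //.
  rewrite -(@ler_pM2l _ (r ^+ 2)) ?exprn_gt0 // mulr1 -exprMn -c2 lerDl.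
  exact: sqr_ge0.
have sa := sin_acos c1; have co : cos (acos c) = c by apply: acosK; rewrite in_itv.
have a0 : 0 <= acos c by exact: acos_ge0.
have api : acos c <= pi by exact: acos_lepi.
have rs : (r * sin (acos c)) ^+ 2 = b ^+ 2.
  rewrite exprMn sa sqr_sqrtr; last first.
    by rewrite subr_ge0 -real_normK ?num_real // expr_le1 // ler_norml.
  by rewrite mulrBr mulr1 -exprMn -c2; ring.
have s0 : 0 <= r * sin (acos c) by rewrite mulr_ge0 // sa sqrtr_ge0.
have [b0|b0] := leP 0 b.
  exists (acos c); first by lra.
  rewrite co -ca; congr (_, _).
  by apply/eqP; rewrite -(@eqrXn2 _ 2) // rs.
exists (2 * pi - acos c); first by lra.
rewrite cosB sinB [2 * pi]mulr_natl cos2pi sin2pi co !mul0r !mul1r addr0 sub0r -ca.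
congr (_, _); rewrite mulrN; apply: oppr_inj; rewrite opprK; apply/eqP.
by rewrite -(@eqrXn2 _ 2) ?oppr_ge0 ?(ltW b0) // sqrrN rs.
Qed.

Local Open Scope ereal_scope.

Lemma measurable_circle (r : R) :
  measurable_fun [set: measurableTypeR R]
   (fun t : R => (r * cos t, r * sin t)%R : plane).
Proof.
by apply: measurable_fun_pair; apply: measurable_funM => //;
  apply: continuous_measurable_fun; [exact: continuous_cos|exact: continuous_sin].
Qed.

Lemma sigma_finite_plane : sigma_finite [set: plane] mu2.
Proof.
pose I (n : nat) : set R := `[(- n%:R)%R, n%:R%R]%classic.
have mI n : measurable (I n) by exact: measurable_itv.
exists (fun n => I n `*` I n).
  apply/esym/seteqP; split => // -[a b] _.
  pose n := maxn (Num.bound `|a|%R) (Num.bound `|b|%R).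
  have le (t : R) : (Num.bound `|t|%R <= n)%N -> (`|t| <= n%:R)%R.
    move=> tn; apply/ltW/(lt_le_trans (archi_boundP _)) => //.
    by rewrite ler_nat.
  exists n => //=; rewrite /I /= !in_itv /= -!ler_norml; split; apply: le.
    exact: leq_maxl.
  exact: leq_maxr.
move=> n; split; first by apply: measurableX; exact: mI.
have Ioo : mu (I n) < +oo.
  by rewrite /I lebesgue_measure_itv /= lte_fin; case: ifP => _; rewrite // -EFinB ltry.
have -> : mu2 (I n `*` I n) = mu (I n) * mu (I n).
  exact: (@product_measure1E _ _ _ _ _ mu mu (I n) (I n) (mI n) (mI n)).
by rewrite lte_mul_pinfty // ge0_fin_numE.
Qed.

(** Both sides are the integral of [h] composed with the rotation by [t], over
    the points [x] and the angles [t]: for fixed [t] the rotation preserves area,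
    and for fixed [x] the rotated points run through the circle of [x]. *)
Lemma polar_integral (h : plane -> \bar R) :
  measurable_fun setT h -> (forall x, 0 <= h x) ->
  (2 * pi)%:E * \int[mu2]_x h x =
  \int[mu2]_x \int[mu]_(t in `[0%R, (2 * pi)%R])
    h (modulus (cplx x) * cos t, modulus (cplx x) * sin t)%R.
Proof.
move=> mh h0; have pi0 := pi_ge0 R.
pose D : set R := `[0%R, (2 * pi)%R]%classic.
have mD : measurable D by exact: measurable_itv.
have muD : mu D = (2 * pi)%:E.
  rewrite /D lebesgue_measure_itv /= lte_fin mulr_gt0 ?pi_gt0 //.
  by rewrite oppr0 adde0.
have D0 t : 0 <= (\1_D t)%:E :> \bar R by rewrite lee_fin.
pose rot (xt : plane * measurableTypeR R) : plane :=
  rotation (cos xt.2) (sin xt.2) xt.1.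
have mcos : measurable_fun [set: plane * measurableTypeR R] (fun xt => cos xt.2 : R).
  apply: measurableT_comp measurable_snd.
  by apply: continuous_measurable_fun; exact: continuous_cos.
have msin : measurable_fun [set: plane * measurableTypeR R] (fun xt => sin xt.2 : R).
  apply: measurableT_comp measurable_snd.
  by apply: continuous_measurable_fun; exact: continuous_sin.
have m11 : measurable_fun [set: plane * measurableTypeR R] (fun xt => xt.1.1 : R).
  by apply: measurableT_comp measurable_fst; exact: measurable_fst.
have m12 : measurable_fun [set: plane * measurableTypeR R] (fun xt => xt.1.2 : R).
  by apply: measurableT_comp measurable_fst; exact: measurable_snd.
have mrot : measurable_fun setT rot.
  apply: measurable_fun_pair.
    by apply: measurable_funB; apply: measurable_funM.
  by apply: measurable_funD; apply: measurable_funM.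
pose k (xt : plane * measurableTypeR R) := (\1_D xt.2)%:E * h (rot xt).
have mk : measurable_fun setT k.
  apply: emeasurable_funM.
    by apply/measurable_EFinP; apply: measurableT_comp measurable_snd.
  exact: measurableT_comp.
have k0 x : 0 <= k x by exact: mule_ge0.
have inD (g : R -> \bar R) : \int[mu]_(t in D) g t = \int[mu]_t ((\1_D t)%:E * g t).
  rewrite integral_mkcond; apply: eq_integral => t _.
  by rewrite patchE indicE; case: ifP => _; rewrite ?mul1e ?mul0e.
transitivity (\int[mu]_t \int[mu2]_x k (x, t)).
  transitivity (\int[mu]_t ((\1_D t)%:E * \int[mu2]_x h x)).
    rewrite ge0_integralZr //; last first.
      by apply: integral_ge0.
      exact/measurable_EFinP.
    by rewrite integral_indic // setIT; congr (_ * _); exact/esym/muD.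
  apply: eq_integral => t _; rewrite /k /= ge0_integralZl //.
    congr (_ * _); rewrite /rot /=.
    by case: (area_preserving_rotation (cos2Dsin2 t)) => _ ->.
  by case: (area_preserving_rotation (cos2Dsin2 t)) => mr _; exact: measurableT_comp.
transitivity (\int[mu2]_x \int[mu]_t k (x, t)).
  apply/esym; pose sf := Measure_isSigmaFinite.Build _ _ _ mu2 sigma_finite_plane.
  pose m2 : {sigma_finite_measure set plane -> \bar R} := HB.pack mu2 sf.
  exact: (@fubini_tonelli _ _ plane (measurableTypeR R) R m2 mu k mk k0).
apply: eq_integral => x _.
rewrite /k /= -inD.
have [s s02 {1}->] := polar_form x.
set r := modulus _.
pose g t := h (r * cos t, r * sin t)%R.
rewrite -[RHS](@ge0_integral_periodic _ _ s g) //.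
- apply: eq_integral => t _; rewrite /g /rot /rotation /=; congr h.
  by rewrite cosD sinD; congr (_, _); ring.
- exact: measurableT_comp (measurable_circle r).
- by move=> t; exact: h0.
- by move=> t; rewrite /g mulr_natl cosD2pi sinD2pi.
Qed.

End polar_coordinates.

(** * Measurability on the disc and the sub-mean value property *)

Section planar_measurability.
Variable R : realType.
Local Notation mu := (@lebesgue_measure R).
Local Notation plane := (measurableTypeR R * measurableTypeR R)%type.
Local Notation mu2 := (mu \x mu)%E.

Lemma measurable_modulus :
  measurable_fun setT (fun x : plane => modulus (cplx x)).
Proof.
apply: (@measurableT_comp _ _ _ _ _ _ (@Num.sqrt R)).
  by apply: continuous_measurable_fun; exact: sqrt_continuous.
by apply: measurable_funD; apply: measurable_funX;
  [exact: measurable_fst|exact: measurable_snd].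
Qed.

Lemma cplxD (x : plane) (z : R[i]) :
  cplx ((x.1 + complex.Re z, x.2 + complex.Im z) : plane) = cplx x + z.
Proof. by case: x z => a b [c d]. Qed.

Lemma measurable_disc_at (z : R[i]) (r : R) :
  measurable [set x : plane | modulus (cplx x - z) <= r].
Proof.
rewrite -[X in measurable X]setTI.
have mt : measurable_fun setT (fun x : plane => modulus (cplx x - z)).
  have -> : (fun x : plane => modulus (cplx x - z)) =
    (fun x : plane => modulus (cplx x)) \o
    (fun x : plane => (x.1 + - complex.Re z, x.2 + - complex.Im z) : plane).
    by apply/funext => -[a b] /=; case: z => c d.
  apply: measurableT_comp; first exact: measurable_modulus.
  by case: (area_preserving_translation (- complex.Re z) (- complex.Im z)).
have -> : [set x : plane | modulus (cplx x - z) <= r] =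
    (fun x : plane => modulus (cplx x - z)) @^-1` `]-oo, r].
  by apply/seteqP; split => x /=; rewrite in_itv.
by apply: mt => //; exact: measurable_itv.
Qed.

Lemma measurable_modulus_itv (i : interval R) :
  measurable [set x : plane | modulus (cplx x) \in i].
Proof.
rewrite -[X in measurable X]setTI.
exact: (measurable_modulus measurableT (measurable_itv i)).
Qed.

Lemma measurable_disc : measurable (@cplx R @^-1` (@disc R)).
Proof.
have := measurable_modulus_itv `]-oo, 1[.
by congr measurable; apply/seteqP; split => x /=; rewrite in_itv.
Qed.

(** The function is the limit of its compositions with roundings of the
    coordinates, which take countably many values on products of intervals. *)
Lemma measurable_continuous_on_disc (u : R[i] -> R) :
  (forall a, disc a -> forall e : R, 0 < e -> exists2 d : R, 0 < d &
     forall b, modulus (b - a) < d -> `|u a - u b| < e) ->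
  measurable_fun (@cplx R @^-1` @disc R) (fun x : plane => u (cplx x)).
Proof.
move=> uc.
pose rnd (n : nat) (t : R) : R := (Num.floor (t * n.+1%:R))%:~R / n.+1%:R.
have rndE n t : `|t - rnd n t| <= n.+1%:R^-1.
  have n0 : 0 < n.+1%:R :> R by rewrite ltr0n.
  rewrite -(ler_pM2r n0) mulVf ?gt_eqF // -[X in _ * X](gtr0_norm n0) -normrM mulrBl /rnd.
  rewrite divfK ?gt_eqF //.
  have := floor_le (t * n.+1%:R); have := floorD1_gt (t * n.+1%:R).
  rewrite intrD; set c := (Num.floor _)%:~R => h1 h2.
  by rewrite ger0_norm ?subr_ge0 // lerBlDl ltW.
pose g n (x : plane) := u (rnd n x.1 +i* rnd n x.2).
have mcell n (i : int) : measurable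
    [set t : measurableTypeR R | Num.floor (t * n.+1%:R) = i].
  have n0 : 0 < n.+1%:R :> R by rewrite ltr0n.
  have -> : [set t : measurableTypeR R | Num.floor (t * n.+1%:R) = i] =
     `[i%:~R / n.+1%:R, (i + 1)%:~R / n.+1%:R[%classic.
    apply/seteqP; split => t /=; rewrite in_itv /= ler_pdivrMr // ltr_pdivlMr //.
      by move=> <-; rewrite floor_le floorD1_gt.
    by move=> h; apply/eqP; rewrite floor_eq.
  exact: measurable_itv.
apply: (@measurable_fun_cvg _ _ _ _ g); last first.
  move=> x xd; apply/cvgrPdist_lt => e e0.
  have [d d0 Hd] := uc _ xd e e0.
  have X0 : 0 <= 2 / d by rewrite divr_ge0 // ltW.
  exists (Num.bound (2 / d)) => // n /= dn; apply: Hd.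
  apply: le_lt_trans (modulus_le_ReIm _) _.
  rewrite /cplx /= -![rnd _ _ - _]opprB !normrN.
  apply: le_lt_trans (lerD (rndE n x.1) (rndE n x.2)) _.
  have n0 : 0 < n.+1%:R :> R by rewrite ltr0n.
  have -> : n.+1%:R^-1 + n.+1%:R^-1 = 2 / n.+1%:R :> R by ring.
  rewrite ltr_pdivrMr // mulrC -ltr_pdivrMr //.
  apply: lt_le_trans (archi_boundP X0) _; rewrite ler_nat; exact: leqW.
move=> n; apply: measurable_funTS => _ B mB; rewrite setTI.
pose F (ij : int * int) : set plane :=
  if (u (ij.1%:~R / n.+1%:R +i* (ij.2%:~R / n.+1%:R)) \in B)
  then [set t : measurableTypeR R | Num.floor (t * n.+1%:R) = ij.1] `*`
       [set t : measurableTypeR R | Num.floor (t * n.+1%:R) = ij.2]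
  else set0.
have -> : g n @^-1` B = \bigcup_ij F ij.
  apply/seteqP; split => [x xB|x [[i j] _]].
    exists (Num.floor (x.1 * n.+1%:R), Num.floor (x.2 * n.+1%:R)) => //.
    by rewrite /F /= mem_set.
  by rewrite /F /=; case: ifPn => [/set_mem|] // uB [/= xi xj]; rewrite /g /rnd xi xj.
apply: countable_bigcupT_measurable; first exact: countableP.
move=> ij; rewrite /F; case: ifP => _ //.
by apply: measurableX; exact: mcell.
Qed.

Lemma measurable_analytic f : analytic_on_disc f ->
  measurable_fun (@cplx R @^-1` @disc R) (fun x : plane => modulus (f (cplx x))).
Proof.
move=> fa; apply: (@measurable_continuous_on_disc (fun z => modulus (f z))).
move=> a ad e e0.
have [c [e1 [e10 fc]]] := fa _ ad.
have [r [M r0 [M0 Lf _]]] := local_cauchy_riemann e10 fc.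
have M10 : 0 < M + 1 by rewrite ltr_wpDl.
exists (Num.min r (e / (M + 1))); first by rewrite lt_min r0 divr_gt0.
move=> b; rewrite lt_min => /andP[br be].
have bE : a + (b - a) = b by ring.
have := Lf _ (ltW br); rewrite bE => Lb.
have h1 := modulusD (f a) (f b - f a); have h2 := modulusD (f b) (f a - f b).
have : modulus (f b - f a) < e.
  apply: le_lt_trans Lb _; move: be; rewrite ltr_pdivlMr //.
  by apply: le_lt_trans; rewrite mulrC ler_wpM2l ?modulus_ge0 // lerDl.
move: h1 h2; rewrite (modulusBC (f a)) !(addrC _ (_ - _)) !subrK.
by rewrite ltr_norml; lra.
Qed.

Lemma disc_area_bounds (r : R) : 0 < r ->
  ((r ^+ 2)%:E <= mu2 [set x : plane | (modulus (cplx x) <= r)%R] < +oo)%E.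
Proof.
move=> r0.
have mD : measurable [set x : plane | modulus (cplx x) <= r].
  have := measurable_modulus_itv `]-oo, r].
  by congr measurable; apply/seteqP; split => x /=; rewrite in_itv.
have sq (s : R) : 0 < s -> mu2 (`[- s, s]%classic `*` `[- s, s]%classic) = ((2 * s) ^+ 2)%:E.
  move=> s0; rewrite product_measure1E //= !lebesgue_measure_itv /= lte_fin.
  rewrite ifT; last by lra.
  by rewrite -EFinB -EFinM opprK -expr2; congr (_ ^+ 2)%:E; ring.
apply/andP; split.
  have -> : r ^+ 2 = (2 * (r / 2)) ^+ 2 by congr (_ ^+ 2); field.
  rewrite -sq ?divr_gt0 //; apply: le_measure; rewrite ?inE //.
    by apply: measurableX; exact: measurable_itv.
  move=> [a b] /= []; rewrite !in_itv /= -!ler_norml => ar br.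
  by apply: (le_trans (modulus_le_ReIm (a +i* b))); rewrite /=; lra.
apply: (@le_lt_trans _ _ (mu2 (`[- r, r]%classic `*` `[- r, r]%classic))).
  apply: le_measure; rewrite ?inE //.
    by apply: measurableX; exact: measurable_itv.
  move=> [a b] /= abr; rewrite !in_itv /= -!ler_norml; split.
    exact: le_trans (Re_le_modulus (a +i* b)) abr.
  exact: le_trans (Im_le_modulus (a +i* b)) abr.
by rewrite sq // ltry.
Qed.

(** The mean value property is integrated over the disc of radius [delta]: each
    of the rotated integrals is the integral of [|f|] over the disc about
    [z]. The constant [delta^2] stands for the area [pi delta^2]. *)
Lemma submean_value f (z : R[i]) (delta : R) : analytic_on_disc f ->
  0 < delta -> modulus z + delta < 1 ->
  ((modulus (f z) * delta ^+ 2)%:E <=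
   \int[mu2]_(x in [set x : plane | (modulus (cplx x - z) <= delta)%R])
     (modulus (f (cplx x)))%:E)%E.
Proof.
move=> fa d0 zd.
set Dz := [set x : plane | _].
have mDz : measurable Dz by exact: measurable_disc_at.
pose D0 := [set x : plane | modulus (cplx x) <= delta].
have mD0 : measurable D0.
  have := measurable_modulus_itv `]-oo, delta].
  by congr measurable; apply/seteqP; split => x /=; rewrite in_itv.
have DzD : Dz `<=` @cplx R @^-1` @disc R.
  move=> x; rewrite /Dz /= => xz; have := modulusD (cplx x - z) z.
  by rewrite subrK => h; apply: le_lt_trans h _; lra.
pose g (x : plane) : R := modulus (f (cplx x)) * \1_Dz x.
have g0 x : 0 <= g x by rewrite mulr_ge0 ?modulus_ge0.
have gE : EFin \o g = (fun x => (modulus (f (cplx x)))%:E) \_ Dz.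
  apply/funext => x /=; rewrite /g patchE indicE.
  by case: ifP => _; rewrite ?mulr1 ?mulr0.
have mg : measurable_fun setT (EFin \o g).
  rewrite gE; apply/(measurable_restrictT _ mDz).
  apply/measurable_EFinP.
  exact: (measurable_funS measurable_disc DzD (measurable_analytic fa)).
rewrite integral_mkcond -gE.
have [m1 m2] := andP (disc_area_bounds d0).
rewrite -/D0 in m1 m2.
set I := (\int[mu2]_x _)%E.
have I0 : (0 <= I)%E by apply: integral_ge0 => x _; rewrite lee_fin.
have [->|Ifin] := eqVneq I +oo%E; first exact: leey.
have Ir : I \is a fin_num by rewrite ge0_fin_numE // ltey.
have mr : mu2 D0 \is a fin_num by rewrite ge0_fin_numE.
rewrite -(fineK Ir) lee_fin; rewrite -(fineK mr) lee_fin in m1.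
apply: (@le_trans _ _ (modulus (f z) * fine (mu2 D0))).
  by rewrite ler_wpM2l ?modulus_ge0.
have m0 : 0 <= fine (mu2 D0) by rewrite fine_ge0.
apply/ler_addgt0Pr => e e0.
pose eps := e / (fine (mu2 D0) + 1).
have m10 : 0 < fine (mu2 D0) + 1 by rewrite ltr_wpDl.
have eps0 : 0 < eps by rewrite divr_gt0.
have [n [w w1 mv]] := mean_value fa (ltW d0) zd eps0.
have n0 : 0 < n.+1%:R :> R by rewrite ltr0n.
have neps : 0 <= n.+1%:R * eps by apply: mulr_ge0 => //; exact: ltW.
pose phi k (x : plane) : plane :=
  ((rotation (complex.Re (w ^+ k)) (complex.Im (w ^+ k)) x).1 + complex.Re z,
   (rotation (complex.Re (w ^+ k)) (complex.Im (w ^+ k)) x).2 + complex.Im z).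
have phiE k x : cplx (phi k x) = z + cplx x * w ^+ k.
  rewrite /phi (cplxD (rotation _ _ _)) addrC; congr (_ + _).
  case: (w ^+ k) x => c s [a b]; rewrite /cplx /rotation /=.
  by apply/eqP; rewrite eq_complex /=; apply/andP; split; apply/eqP; ring.
have mwk k : modulus (w ^+ k) = 1 by rewrite modulusX w1 expr1n.
have phia k : area_preserving (phi k).
  apply: (area_preserving_comp (area_preserving_translation (complex.Re z) (complex.Im z))
    (@area_preserving_rotation _ (complex.Re (w ^+ k)) (complex.Im (w ^+ k)) _)).
  have := mwk k; case: (w ^+ k) => c s /= cs.
  by rewrite -[LHS]sqr_sqrtr ?cs ?expr1n // addr_ge0 ?sqr_ge0.
have key x : ((n.+1%:R * modulus (f z) * \1_D0 x)%:E <=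
    \sum_(0 <= k < n.+1) (EFin \o g) (phi k x) + (n.+1%:R * eps * \1_D0 x)%:E)%E.
  rewrite sumEFin -EFinD lee_fin indicE.
  have [xD|xD] := boolP (x \in D0); last first.
    by rewrite !mulr0 addr0 sumr_ge0.
  rewrite !mulr1; move: xD; rewrite inE /= => xD.
  have := mv _ xD; set S := cyclic_sum _ _ _ _ _ => Sb.
  have := modulusB S (S - n.+1%:R * f z).
  have -> : S - (S - n.+1%:R * f z) = n.+1%:R * f z by ring.
  rewrite modulusM modulus_nat => h.
  apply: le_trans h _; apply: lerD Sb.
  apply: le_trans (modulus_sum _ _) _; apply: ler_sum => k _.
  have inDz : Dz (phi k x).
    rewrite /Dz /= phiE.
    have -> : z + cplx x * w ^+ k - z = cplx x * w ^+ k by ring.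
    by rewrite modulusM mwk mulr1.
  by rewrite /g phiE indicE mem_set // mulr1.
have mphi k : measurable_fun setT (fun x => (EFin \o g) (phi k x)).
  by apply: measurableT_comp => //; case: (phia k).
have mind (c : R) : measurable_fun setT (fun x : plane => (c * \1_D0 x)%:E).
  apply/measurable_EFinP; apply: measurable_funM => //.
have iind (c : R) : 0 <= c ->
    (\int[mu2]_x (c * \1_D0 x)%:E = (c * fine (mu2 D0))%:E)%E.
  move=> c0; under eq_integral do rewrite EFinM.
  rewrite ge0_integralZl_EFin //; last exact/measurable_EFinP.
  by rewrite integral_indic // setIT EFinM fineK.
have : (\int[mu2]_x (n.+1%:R * modulus (f z) * \1_D0 x)%:E <=
    \int[mu2]_x (\sum_(0 <= k < n.+1) (EFin \o g) (phi k x) +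
                 (n.+1%:R * eps * \1_D0 x)%:E))%E.
  apply: ge0_le_integral => //.
  - by move=> x _; rewrite lee_fin !mulr_ge0 ?modulus_ge0.
  - by apply: emeasurable_funD => //; apply: emeasurable_sum.
rewrite ge0_integralD //; last 3 first.
- by move=> x _; apply: sume_ge0 => k _; rewrite lee_fin.
- exact: emeasurable_sum.
- by move=> x _; rewrite lee_fin; exact: mulr_ge0.
rewrite ge0_integral_sum //; last by move=> k x _; rewrite lee_fin.
have phiI k : (\int[mu2]_x (EFin \o g) (phi k x) = I)%E.
  by case: (phia k) => _ -> // x; rewrite lee_fin.
under eq_bigr do rewrite phiI.
rewrite !iind //; last by apply: mulr_ge0 => //; exact: modulus_ge0.
rewrite -(fineK Ir) sumEFin -EFinD lee_fin sumr_const_nat subn0 -[fine I *+ _]mulr_natl /=.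
rewrite -!mulrA -mulrDr ler_pM2l // => h; apply: le_trans h _; rewrite lerD2l.
apply: ler_piMr; first exact: ltW.
by rewrite mulrC ler_pdivrMr // mul1r lerDl.
Qed.

End planar_measurability.

(** * Growth of functions with a finite area integral *)

Section growth.
Variable R : realType.
Local Notation mu := (@lebesgue_measure R).
Local Notation plane := (measurableTypeR R * measurableTypeR R)%type.
Local Notation mu2 := (mu \x mu)%E.
Implicit Types (z : R[i]) (f : R[i] -> R[i]).

Lemma measurable_fun_powR d (T : measurableType d) (D : set T) (u v : T -> R) :
  measurable D -> measurable_fun D u -> measurable_fun D v ->
  (forall x, D x -> 0 <= u x /\ v x != 0) ->
  measurable_fun D (fun x => u x `^ v x).
Proof.
move=> mD mu' mv uv0.
apply: (@eq_measurable_fun _ _ _ _ D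
   (fun x => if u x == 0 then 0 else expR (v x * ln (u x)))).
  by move=> x /set_mem /uv0[_ v0]; rewrite /powR (negbTE v0).
apply: measurable_fun_if => //.
  by apply: measurable_fun_eqr => //.
apply: (@measurableT_comp _ _ _ _ _ _ (@expR R)) => //.
apply: measurable_funM.
  by apply: measurable_funS mv => // x [].
apply: (@measurableT_comp _ _ _ _ _ _ (@ln R)) => //.
by apply: measurable_funS mu' => // x [].
Qed.

Lemma ler_powR_base (x y r : R) : 0 <= r -> 0 <= x -> x <= y -> x `^ r <= y `^ r.
Proof.
by move=> r0 x0 xy; apply: ge0_ler_powR => //; rewrite nnegrE // (le_trans x0).
Qed.

Lemma powR_split (y q : R) : 0 <= y -> 0 < q -> y = y `^ q * y `^ (1 - q).
Proof.
move=> y0 q0; have [->|yn] := eqVneq y 0.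
  by rewrite powR0 ?mul0r // gt_eqF.
by rewrite -powRD ?yn ?implybT // addrC subrK powRr1.
Qed.

Lemma measurable_weight (beta : R) :
  measurable_fun (@cplx R @^-1` @disc R)
    (fun x : plane => (1 - modulus (cplx x) ^+ 2) `^ beta).
Proof.
apply: (@measurableT_comp _ _ _ _ _ _ (fun t : R => t `^ beta)).
  exact: measurable_powR.
apply: measurable_funTS; apply: measurable_funB => //.
by apply: measurable_funX; exact: measurable_modulus.
Qed.

(** Let [T] be the supremum of [|f z| (rho - |z|)^N] over [|z| < rho]. On the
    disc of radius [delta = (rho - |z|) / 2] about [z], writing
    [|f| = |f|^q |f|^(1 - q)] and bounding the second factor by means of [T],
    the sub-mean value property gives [T <= 2^N I T^(1 - q)] when
    [N q = 2 + beta]. As [T] is finite, it is bounded independently of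
    [rho]. *)
Lemma growth_on_smaller_disc f (q beta rho : R) : analytic_on_disc f ->
  0 < q <= 1 -> 0 <= beta -> 0 < rho < 1 ->
  let N := (2 + beta) / q in
  let I := (\int[mu2]_(x in @cplx R @^-1` @disc R)
    (modulus (f (cplx x)) `^ q * (1 - modulus (cplx x) ^+ 2) `^ beta)%R%:E)%E in
  (I < +oo)%E -> forall z, modulus z < rho ->
  modulus (f z) * (rho - modulus z) `^ N <= (2 `^ N * fine I) `^ q^-1.
Proof.
move=> fa /andP[q0 q1] b0 /andP[rho0 rho1] N I Ioo.
have N0 : 0 <= N by rewrite divr_ge0 ?addr_ge0 // ltW.
have I0 : (0 <= I)%E.
  by apply: integral_ge0 => x _; rewrite lee_fin mulr_ge0 // powR_ge0.
have Ir : I \is a fin_num by rewrite ge0_fin_numE.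
have r0 : 0 <= fine I by rewrite fine_ge0.
have [B B0 HB] := analytic_bounded fa rho1.
pose E := [set y | exists2 z, modulus z < rho &
  y = modulus (f z) * (rho - modulus z) `^ N].
have Esup : has_sup E.
  split.
    by exists (modulus (f 0) * (rho - modulus (0 : R[i])) `^ N), 0; rewrite ?modulus0.
  exists B => _ [z zr ->].
  rewrite -[leRHS]mulr1; apply: ler_pM; rewrite ?modulus_ge0 ?powR_ge0 //.
    by apply: HB; exact: ltW.
  have one : 1 `^ N = 1 :> R by rewrite powR1.
  rewrite -[leRHS]one; apply: ler_powR_base => //; have := modulus_ge0 z; lra.
pose T := sup E.
have leT z : modulus z < rho -> modulus (f z) * (rho - modulus z) `^ N <= T.
  by move=> zr; apply: ub_le_sup; [case: Esup|exists z].
have T0 : 0 <= T.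
  apply: le_trans (leT 0 _); last by rewrite modulus0.
  by rewrite mulr_ge0 ?modulus_ge0 ?powR_ge0.
have key z : modulus z < rho -> modulus (f z) * (rho - modulus z) `^ N <=
    2 `^ N * fine I * T `^ (1 - q).
  move=> zr; have z0 := modulus_ge0 z.
  pose delta := (rho - modulus z) / 2.
  have d0 : 0 < delta by rewrite divr_gt0 // subr_gt0.
  have zd : modulus z + delta < 1 by rewrite /delta; lra.
  have := submean_value fa d0 zd; set Dz := [set x : plane | _] => sub.
  have mDz : measurable Dz by exact: measurable_disc_at.
  pose k := (delta `^ N) `^ (1 - q) * delta `^ beta.
  have k0 : 0 <= k by rewrite mulr_ge0 ?powR_ge0.
  have Dzrho x : Dz x -> modulus (cplx x) + delta <= rho.
    rewrite /Dz /= => xz; have := modulusD (cplx x - z) z; rewrite subrK => h.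
    have rE : rho = delta + modulus z + delta by rewrite /delta; field.
    by rewrite rE lerD2r (le_trans h) // lerD2r.
  have DzD : Dz `<=` @cplx R @^-1` @disc R.
    move=> x /Dzrho h; apply: (le_lt_trans _ rho1); apply: le_trans h.
    by rewrite lerDl ltW.
  have mf := measurable_analytic fa.
  have mh : measurable_fun (@cplx R @^-1` @disc R) (fun x : plane =>
      (modulus (f (cplx x)) `^ q * (1 - modulus (cplx x) ^+ 2) `^ beta)%:E).
    apply/measurable_EFinP; apply: measurable_funM; last exact: measurable_weight.
    apply: (@measurableT_comp _ _ _ _ _ _ (fun t : R => t `^ q)).
      exact: measurable_powR.
    exact: mf.
  have mDS (g : plane -> \bar R) : measurable_fun (@cplx R @^-1` @disc R) g ->
      measurable_fun Dz g.
    exact: (measurable_funS (@measurable_disc R) DzD).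
  have h0 x : (0 <= (modulus (f (cplx x)) `^ q * (1 - modulus (cplx x) ^+ 2) `^ beta)%:E)%E.
    by rewrite lee_fin mulr_ge0 ?powR_ge0.
  have step : (k%:E * \int[mu2]_(x in Dz) (modulus (f (cplx x)))%:E <=
      (T `^ (1 - q))%:E * I)%E.
    rewrite -ge0_integralZl_EFin //; last 2 first.
    - by move=> x _; rewrite lee_fin modulus_ge0.
    - by apply: mDS; apply/measurable_EFinP.
    rewrite -ge0_integralZl_EFin ?powR_ge0 //; last exact: measurable_disc.
    apply: (@le_trans _ _ (\int[mu2]_(x in Dz) ((T `^ (1 - q))%:E *
      (modulus (f (cplx x)) `^ q * (1 - modulus (cplx x) ^+ 2) `^ beta)%:E))%E); last first.
      apply: ge0_subset_integral => //; first exact: measurable_disc.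
        exact: measurable_funeM.
      by move=> x _; rewrite mule_ge0 // lee_fin powR_ge0.
    apply: ge0_le_integral => //.
    - by move=> x _; rewrite -EFinM lee_fin mulr_ge0 // modulus_ge0.
    - by apply: measurable_funeM; apply: mDS; apply/measurable_EFinP.
    - by apply: measurable_funeM; apply: mDS.
    move=> x xD; rewrite -!EFinM lee_fin.
    have xr := Dzrho _ xD; set y := modulus (f (cplx x)).
    have y0 : 0 <= y by exact: modulus_ge0.
    have x0 := modulus_ge0 (cplx x).
    have yT : y * delta `^ N <= T.
      apply: le_trans (leT (cplx x) _); last by lra.
      by apply: ler_wpM2l => //; apply: ler_powR_base => //; [exact: ltW|lra].
    have yT' : y `^ (1 - q) * (delta `^ N) `^ (1 - q) <= T `^ (1 - q).
      rewrite -powRM ?powR_ge0 //; apply: ler_powR_base => //; first by rewrite subr_ge0.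
      by rewrite mulr_ge0 // powR_ge0.
    have wd : delta `^ beta <= (1 - modulus (cplx x) ^+ 2) `^ beta.
      apply: ler_powR_base => //; first exact: ltW.
      have : modulus (cplx x) ^+ 2 <= modulus (cplx x) by rewrite expr2 ler_piMl //; lra.
      lra.
    rewrite [X in k * X](powR_split y0 q0) /k.
    have -> : (delta `^ N) `^ (1 - q) * delta `^ beta * (y `^ q * y `^ (1 - q)) =
       (y `^ (1 - q) * (delta `^ N) `^ (1 - q)) * (y `^ q * delta `^ beta) by ring.
    apply: ler_pM => //; rewrite ?mulr_ge0 ?powR_ge0 //.
    by apply: ler_wpM2l => //; exact: powR_ge0.
  have : (k%:E * (modulus (f z) * delta ^+ 2)%:E <= (T `^ (1 - q))%:E * I)%E.
    by apply: le_trans step; rewrite lee_wpmul2l.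
  rewrite -(fineK Ir) -!EFinM lee_fin /= => le1.
  have rE : rho - modulus z = 2 * delta by rewrite /delta; field.
  (* The choice of [N]: [N (1 - q) + beta + 2 = N]. *)
  have kE : k * delta ^+ 2 = delta `^ N.
    rewrite /k -powRrM -powR_mulrn ?ltW // -!powRD ?(gt_eqF d0) ?implybT //.
    by congr (_ `^ _); rewrite /N; field; rewrite gt_eqF.
  rewrite rE powRM ?(ltW d0) // -kE.
  have -> : modulus (f z) * (2 `^ N * (k * delta ^+ 2)) =
     2 `^ N * (k * (modulus (f z) * delta ^+ 2)) by ring.
  rewrite -mulrA; apply: ler_wpM2l; first exact: powR_ge0.
  by rewrite [leRHS]mulrC.
have TA : T <= 2 `^ N * fine I * T `^ (1 - q).
  by apply: ge_sup; [case: Esup|move=> _ [z zr ->]; exact: key].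
move=> z zr; apply: le_trans (leT z zr) _.
have [->|Tn] := eqVneq T 0; first exact: powR_ge0.
have Tp : 0 < T by rewrite lt_neqAle eq_sym Tn.
have Tq : T `^ q <= 2 `^ N * fine I.
  move: TA; rewrite [X in X <= _](powR_split T0 q0) ler_pM2r //.
  exact: powR_gt0.
have TE : T = (T `^ q) `^ q^-1 by rewrite -powRrM divff ?powRr1 // gt_eqF.
rewrite [leLHS]TE.
by apply: ler_powR_base; [rewrite invr_ge0 ltW|exact: powR_ge0|exact: Tq].
Qed.

(** The bound on [|z| < rho] at [rho = (1 + |z|) / 2]. *)
Lemma growth_estimate f (q beta : R) : analytic_on_disc f ->
  0 < q <= 1 -> 0 <= beta ->
  (\int[mu2]_(x in @cplx R @^-1` @disc R)
    (modulus (f (cplx x)) `^ q * (1 - modulus (cplx x) ^+ 2) `^ beta)%R%:E < +oo)%E ->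
  exists K N : R, [/\ 0 < K, 0 <= N &
    forall z, disc z -> modulus (f z) <= K * (1 - modulus z) `^ (- N)].
Proof.
move=> fa q01 b0 Ioo; have /andP[q0 q1] := q01.
set I := (\int[mu2]_(x in _) _)%E in Ioo.
pose N := (2 + beta) / q; pose A := (2 `^ N * fine I) `^ q^-1.
have N0 : 0 <= N by rewrite divr_ge0 ?addr_ge0 // ltW.
have A0 : 0 <= A by exact: powR_ge0.
exists ((A + 1) * 2 `^ N), N; split => //.
  by rewrite mulr_gt0 ?powR_gt0 // ltr_wpDl.
move=> z zd; have z0 := modulus_ge0 z; have zd' : modulus z < 1 by [].
have rho01 : 0 < (1 + modulus z) / 2 < 1 by apply/andP; split; lra.
have zr : modulus z < (1 + modulus z) / 2 by lra.
have := growth_on_smaller_disc fa q01 b0 rho01 Ioo zr.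
rewrite -/N -/A.
have -> : (1 + modulus z) / 2 - modulus z = (1 - modulus z) * 2^-1 by field.
rewrite powRM ?invr_ge0 ?subr_ge0 ?(ltW zd') //.
have p0 : 0 < (1 - modulus z) `^ N by rewrite powR_gt0 // subr_gt0.
have t0 : 0 < 2 `^ N :> R by rewrite powR_gt0.
have -> : 2^-1 `^ N = (2 `^ N)^-1 :> R.
  by rewrite -powR_inv1 // -powRrM mulN1r powRN.
rewrite mulrA ler_pdivrMr // powRN ler_pdivlMr // => h; apply: le_trans h _.
by apply: ler_wpM2r; [exact: ltW|rewrite lerDl].
Qed.

End growth.

(** * Exponents and directions *)

Section directions.
Variable R : realType.
Local Notation mu := (@lebesgue_measure R).
Local Notation plane := (measurableTypeR R * measurableTypeR R)%type.
Local Notation mu2 := (mu \x mu)%E.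
Implicit Types (z : R[i]) (p : R[i] -> R).

Definition direction (x : plane) : plane :=
  (x.1 * (modulus (cplx x))^-1, x.2 * (modulus (cplx x))^-1).

Lemma cplx_direction x : cplx (direction x) = cplx x / `|cplx x|.
Proof.
rewrite normr_modulus -fmorphV; case: x => a b.
by apply/eqP; rewrite eq_complex /= !mulr0 subr0 add0r !eqxx.
Qed.

Lemma measurable_direction : measurable_fun setT direction.
Proof.
have mV : measurable_fun setT (fun x : plane => (modulus (cplx x))^-1).
  have -> : (fun x : plane => (modulus (cplx x))^-1) =
     (fun t : R => t `^ (-1)) \o (fun x : plane => modulus (cplx x)).
    by apply/funext => x /=; rewrite powR_inv1 // modulus_ge0.
  by apply: measurableT_comp; [exact: measurable_powR|exact: measurable_modulus].
by apply: measurable_fun_pair; apply: measurable_funM.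
Qed.

Lemma closed_disc_unit z : closed_disc (z / `|z|).
Proof.
rewrite /closed_disc; change (modulus (z / `|z|) <= 1).
rewrite normr_modulus modulusM modulusV modulusR ger0_norm ?modulus_ge0 //.
by have [->|z0] := eqVneq (modulus z) 0; [rewrite mul0r|rewrite divff].
Qed.

Lemma polarE (r t : R) : cplx ((r * cos t, r * sin t) : plane) = polar r t.
Proof.
by apply/eqP; rewrite /polar eq_complex /= !mul0r subr0 addr0 !eqxx.
Qed.

Lemma modulus_polar (r t : R) : 0 <= r -> modulus (polar r t) = r.
Proof.
by move=> r0; rewrite /polar modulusM modulusR ger0_norm // (modulus_cis t) mulr1.
Qed.

Lemma exists_polar (z : R[i]) : exists t, z = polar (modulus z) t.
Proof.
have [t _ zt] := polar_form (complex.Re z, complex.Im z).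
have zE : cplx ((complex.Re z, complex.Im z) : plane) = z by case: z {zt}.
by exists t; have := congr1 (@cplx R) zt; rewrite polarE zE.
Qed.

Lemma radial_exponent_polar p (r t : R) : 0 < r ->
  radial_exponent p (polar r t) = p (polar 1 t).
Proof.
move=> r0; rewrite /radial_exponent normr_modulus (modulus_polar _ (ltW r0)).
congr p; rewrite /polar mul1r mulrAC divff ?mul1r //.
by rewrite (inj_eq (@complexI R)) gt_eqF.
Qed.

Lemma measurable_angles (G : set plane) : measurable G ->
  measurable [set t : measurableTypeR R |
    `[0%R, (2 * pi)%R]%classic t /\ G ((cos t, sin t) : plane)].
Proof.
move=> mG.
have cE : (fun t : R => (1 * cos t, 1 * sin t) : plane) = (fun t => (cos t, sin t)).
  by apply/funext => t; rewrite !mul1r.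
have := measurable_circle 1 measurableT mG; rewrite cE setTI => mc.
exact: (measurableI _ _ (measurable_itv _) mc).
Qed.

(** The circular means of the indicator function of a truncated cone are
    constant on the radii in [i] and vanish elsewhere. This transfers null sets
    between the plane and the circle. *)
Lemma cone_area (G : set plane) (i : interval R) : measurable G ->
  (forall r, r \in i -> 0 < r) ->
  ((2 * pi)%:E *
     mu2 [set x | (modulus (cplx x) \in i) /\ G (direction x)] =
   mu [set t | `[0%R, (2 * pi)%R]%classic t /\ G ((cos t, sin t) : plane)] *
     mu2 [set x | (modulus (cplx x) \in i)])%E.
Proof.
move=> mG i0.
set S := [set x : plane | _ /\ _].
set E := [set t : R | _ /\ _]; set Q := [set x : plane | _ \in i].
have mQ : measurable Q by exact: measurable_modulus_itv.
have mS : measurable S.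
  have -> : S = Q `&` (direction @^-1` G) by [].
  apply: measurableI => //; rewrite -[X in measurable X]setTI.
  exact: measurable_direction.
have mE : measurable E by exact: measurable_angles.
have mind : measurable_fun setT (fun x : plane => (\1_S x : R)%:E).
  exact/measurable_EFinP.
have -> : mu2 S = (\int[mu2]_x (\1_S x : R)%:E)%E by rewrite integral_indic // setIT.
rewrite (polar_integral mind) //.
transitivity (\int[mu2]_x (mu E * (\1_Q x : R)%:E))%E; last first.
  rewrite ge0_integralZl ?integral_indic ?setIT //; last exact/measurable_EFinP.
apply: eq_integral => x _.
set r := modulus (cplx x).
transitivity (\int[mu]_(t in `[0%R, (2 * pi)%R]) ((\1_Q x : R) * \1_E t)%:E)%E.
  apply: eq_integral => t /set_mem t02; congr (_%:E).
  have r0 : 0 <= r by exact: modulus_ge0.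
  have mr : modulus (cplx ((r * cos t, r * sin t) : plane)) = r.
    by rewrite polarE modulus_polar.
  rewrite !indicE; have [xQ|xQ] := boolP (x \in Q); last first.
    rewrite mul0r memNset // => -[]; rewrite mr => ri _.
    by move/negP: xQ; apply; rewrite inE.
  rewrite mul1r; congr (nat_of_bool _)%:R.
  have rp : 0 < r by apply: i0; move: xQ; rewrite inE.
  have dE : direction ((r * cos t, r * sin t) : plane) = (cos t, sin t).
    rewrite /direction mr /= ![r * _]mulrC -!mulrA divff ?mulr1 //.
    by rewrite gt_eqF.
  apply/idP/idP; rewrite !inE.
    by move=> [_]; rewrite dE.
  by move=> [_ Gt]; split; rewrite ?mr ?dE //; move: xQ; rewrite inE.
under eq_integral do rewrite EFinM.
rewrite ge0_integralZl_EFin //; last first.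
  exact/measurable_EFinP.
rewrite integral_indic // muleC; congr (mu _ * _)%E.
by apply/seteqP; split => t //= [].
Qed.

(** The annulus contains a rectangle. *)
Lemma annulus_area_gt0 (a : R) : 0 <= a < 1 ->
  (0 < mu2 [set x | (modulus (cplx x) \in `[a, 1%R[)%R])%E.
Proof.
move=> /andP[a0 a1]; pose d := (1 - a) / 4.
have d0 : 0 < d by rewrite divr_gt0 // subr_gt0.
have aE : a = 1 - 4 * d by rewrite /d; field.
pose A : set R := `[a, a + d]%classic; pose B : set R := `[0, d]%classic.
apply: (@lt_le_trans _ _ (mu2 (A `*` B))).
  have -> : (mu2 (A `*` B) = mu A * mu B)%E.
    by apply: (@product_measure1E _ _ _ _ _ mu mu); exact: measurable_itv.
  rewrite !lebesgue_measure_itv /= !lte_fin ltrDl d0 -!EFinB -EFinM lte_fin.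
  by rewrite subr0 addrC addKr mulr_gt0.
apply: le_measure; rewrite ?inE.
- by apply: measurableX; exact: measurable_itv.
- exact: measurable_modulus_itv.
move=> [x y] []; rewrite /A /B /= !in_itv /= => /andP[ax xa] /andP[y0 yd].
apply/andP; split.
  apply: le_trans ax _; apply: le_trans (ler_norm _) _.
  exact: (Re_le_modulus (x +i* y)).
apply: le_lt_trans (modulus_le_ReIm (x +i* y)) _; rewrite /=.
by rewrite !ger0_norm //; lra.
Qed.

End directions.

Section exponents.
Variable R : realType.
Local Notation mu := (@lebesgue_measure R).
Local Notation plane := (measurableTypeR R * measurableTypeR R)%type.
Local Notation mu2 := (mu \x mu)%E.
Implicit Types (z : R[i]) (p : R[i] -> R).

(** What the comparison of the spaces uses of an exponent. The lower bound is
    asked for almost everywhere on each circle near the boundary, which is more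
    than almost everywhere in the disc. *)
Record tame_exponent (q K r1 : R) p : Prop := TameExponent {
  tame_measurable : measurable_fun (@cplx R @^-1` @closed_disc R) (p \o @cplx R);
  tame_gt0 : forall z, closed_disc z -> 0 < p z;
  tame_disc : {ae mu2, forall x, disc (cplx x) -> q <= p (cplx x) <= K};
  tame_circle : forall r, r1 <= r < 1 ->
    {ae mu, forall t, `[0, 2 * pi]%classic t -> q <= p (polar r t)} }.

Definition log_close (r1 C : R) p1 p2 :=
  forall z, r1 <= modulus z < 1 -> `|p1 z - p2 z| <= C / - ln (1 - modulus z).

Lemma log_closeC r1 C p1 p2 : log_close r1 C p1 p2 -> log_close r1 C p2 p1.
Proof. by move=> h z zr; rewrite distrC; exact: h. Qed.

Lemma measurable_radial_exponent p :
  measurable_fun (@cplx R @^-1` @closed_disc R) (p \o @cplx R) ->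
  measurable_fun (@cplx R @^-1` @closed_disc R) (radial_exponent p \o @cplx R).
Proof.
move=> mp.
have -> : radial_exponent p \o @cplx R = (p \o @cplx R) \o @direction R.
  by apply/funext => x /=; rewrite /radial_exponent cplx_direction.
apply: measurable_comp mp _; first exact: measurable_closed_disc.
  move=> _ [x _ <-]; change (closed_disc (cplx (direction x))); rewrite cplx_direction; exact: closed_disc_unit.
by apply: measurable_funTS; exact: measurable_direction.
Qed.

Lemma radial_exponent_gt0 p : (forall z, closed_disc z -> 0 < p z) ->
  forall z : R[i], closed_disc z -> 0 < radial_exponent p z.
Proof.
by move=> p0 z _; apply: p0; exact: closed_disc_unit.
Qed.

Lemma area_eq0 (A : set plane) : measurable A -> area R A = 0%E -> mu2 A = 0%E.
Proof.
move=> mA; rewrite /area /mscale /= => /eqP; rewrite mule_eq0 eqe invr_eq0.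
by rewrite gt_eqF ?pi_gt0 //= => /eqP.
Qed.

Lemma variable_exponent_bounds p : variable_exponent p ->
  exists q K : R, [/\ 0 < q, q <= K &
   {ae mu2, forall x, closed_disc (cplx x) -> q <= p (cplx x) <= K}].
Proof.
move=> [mp p0 [i0 ile soo]].
have ifin : exponent_inf p \is a fin_num.
  by rewrite ge0_fin_numE ?(ltW i0) // (le_lt_trans ile).
have sfin : exponent_sup p \is a fin_num.
  by rewrite ge0_fin_numE // (le_trans (ltW i0)).
exists (fine (exponent_inf p)), (fine (exponent_sup p)); split.
- by rewrite fine_gt0 // i0 ltey_eq ifin.
- by rewrite fine_le.
have [N1 [mN1 N10 S1]] := ess_inf_le (mrestr (area R) (@measurable_closed_disc R))
   (fun x => (p (cplx x))%:E).
have [N2 [mN2 N20 S2]] := ess_sup_ge (mrestr (area R) (@measurable_closed_disc R))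
   (fun x => (p (cplx x))%:E).
have mcd := @measurable_closed_disc R.
exists ((N1 `|` N2) `&` @cplx R @^-1` @closed_disc R); split.
- by apply: measurableI => //; exact: measurableU.
- have n1 : mu2 (N1 `&` @cplx R @^-1` @closed_disc R) = 0%E.
    by apply: area_eq0 => //; exact: measurableI.
  have n2 : mu2 (N2 `&` @cplx R @^-1` @closed_disc R) = 0%E.
    by apply: area_eq0 => //; exact: measurableI.
  by rewrite setIUl measureU0 //; apply: measurableI.
move=> x /= /not_implyP[xd xp]; split => //.
apply: contrapT => /not_orP[x1 x2]; apply: xp.
have h1 : (exponent_inf p <= (p (cplx x))%:E)%E.
  by apply: contrapT => h; apply: x1; apply: S1.
have h2 : ((p (cplx x))%:E <= exponent_sup p)%E.
  by apply: contrapT => h; apply: x2; apply: S2.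
by rewrite -!lee_fin !fineK // h1 h2.
Qed.

(** Radially close to the boundary [p] differs from its boundary value by at
    most [q0 / 4], so a direction in which the boundary value is not between
    [3/4 q0] and [K0 + q0/4] is the direction of a segment on which [p] is not
    between [q0] and [K0]. The cone over such directions is thus contained in a
    null set, hence the set [E] of these directions is null; then the cone over [E] in the
    whole disc is null too, which bounds [p^] almost everywhere. *)
Lemma tame_exponents p : variable_exponent p -> radially_log_holder p ->
  exists q K r1 C, [/\ 0 < q <= 1, 0 < r1 < 1,
    log_close r1 C p (radial_exponent p),
    tame_exponent q K r1 p & tame_exponent q K r1 (radial_exponent p)].
Proof.
move=> vp [r0 [/andP[r00 r01] [C HC]]].
have [q0 [K0 [q00 qK0 [N [mN N0 SN]]]]] := variable_exponent_bounds vp.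
have [mp p0 _] := vp.
(* [expR (- 4 |C| / q0)] is the distance to the circle at which
   [|C| / - ln (1 - r)] equals [q0 / 4]. *)
pose s := Num.min (1 - r0) (Num.min 2^-1 (expR (- (4 * `|C| / q0)))).
have s0 : 0 < s by rewrite !lt_min subr_gt0 r01 invr_gt0 ltr0n expR_gt0.
have sr : s <= 1 - r0 by rewrite ge_min lexx.
have s2 : s <= 2^-1 by rewrite !ge_min lexx orbT.
have se : s <= expR (- (4 * `|C| / q0)) by rewrite !ge_min lexx !orbT.
pose r1 := 1 - s.
have r10 : 0 < r1 by rewrite /r1; lra.
have r11 : r1 < 1 by rewrite /r1; lra.
have small r : r1 <= r < 1 -> C / - ln (1 - r) <= q0 / 4.
  move=> /andP[rr1 r1'].
  have l1 : 4 * `|C| / q0 <= - ln (1 - r).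
    rewrite lerNr -[leRHS]expRK ler_ln ?posrE ?subr_gt0 ?expR_gt0 //.
    by apply: le_trans se; move: rr1; rewrite /r1; lra.
  have l0 : 0 < - ln (1 - r).
    by rewrite oppr_gt0 ln_lt0 //; apply/andP; split; lra.
  rewrite ler_pdivrMr //; apply: le_trans (ler_norm C) _.
  by move: l1; rewrite ler_pdivrMr //; nra.
have close : log_close r1 C p (radial_exponent p).
  move=> z /andP[rz z1]; have [t zt] := exists_polar z.
  have z0 : 0 < modulus z by exact: lt_le_trans rz.
  rewrite {1 2}zt radial_exponent_polar //.
  by apply: HC => //; rewrite z1 andbT; move: rz; rewrite /r1; lra.
have mcd := @measurable_closed_disc R.
pose a := 3 / 4 * q0; pose b := K0 + q0 / 4.
pose G := @cplx R @^-1` @closed_disc R `&` (p \o @cplx R) @^-1` (~` `[a, b]%classic).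
have mG : measurable G.
  by apply: mp => //; apply: measurableC; exact: measurable_itv.
have Gpolar t : G ((cos t, sin t) : plane) <-> ~ (a <= p (polar 1 t) <= b).
  have cE : cplx ((cos t, sin t) : plane) = polar 1 t.
    by rewrite -polarE !mul1r.
  rewrite /G /= cE in_itv /=; split => [[]//|h]; split => //.
  by change (modulus (polar 1 t) <= 1); rewrite modulus_polar.
pose E := [set t : R | `[0%R, (2 * pi)%R]%classic t /\ G ((cos t, sin t) : plane)].
have cone0 : mu2 [set x | (modulus (cplx x) \in `[r1, 1[) /\ G (direction x)] = 0%E.
  apply: (@subset_measure0 _ _ _ mu2 _ N) => //.
    have -> : [set x | (modulus (cplx x) \in `[r1, 1[) /\ G (direction x)] =
       [set x | modulus (cplx x) \in `[r1, 1[] `&` (@direction R @^-1` G) by [].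
    apply: measurableI; first exact: measurable_modulus_itv.
    by rewrite -[X in measurable X]setTI; exact: measurable_direction.
  move=> x [xr0 Gx]; apply: SN => h.
  have xr : r1 <= modulus (cplx x) < 1 by move: xr0; rewrite in_itv.
  have /andP[xr1 xr2] := xr.
  have cx : closed_disc (cplx x) by exact: ltW.
  have := h cx; have := close _ xr; have := small _ xr.
  move: Gx; rewrite /G /= cplx_direction => -[_].
  rewrite -/(radial_exponent p (cplx x)) in_itv /=.
  move=> ng sm cl /andP[h1 h2]; apply: ng.
  by move: (le_trans cl sm); rewrite ler_norml /a /b; lra.
have E0 : mu E = 0%E.
  have i0 r : r \in `[r1, 1[ -> 0 < r by rewrite in_itv /=; lra.
  have := cone_area mG i0; rewrite cone0 mule0 => /esym/eqP.
  rewrite mule_eq0 => /orP[/eqP//|/eqP h].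
  have : 0 <= r1 < 1 by rewrite ltW.
  by move/annulus_area_gt0; rewrite h ltxx.
have mE : measurable E by exact: measurable_angles.
have cone'0 : mu2 [set x | (modulus (cplx x) \in `]0, 1[) /\ G (direction x)] = 0%E.
  have i0 (r : R) : r \in `]0, 1[ -> 0 < r by rewrite in_itv /=; lra.
  have := cone_area mG i0; rewrite -/E E0 mul0e => /eqP.
  by rewrite mule_eq0 eqe gt_eqF ?mulr_gt0 ?pi_gt0 //= => /eqP.
(* [p 0] enters because the radial exponent is [p 0] at the origin. *)
pose q := Num.min 1 (Num.min (q0 / 2) (p 0)); pose K := Num.max b (p 0).
have p00 : 0 < p 0.
  by apply: p0; change (modulus (0 : R[i]) <= 1); rewrite modulus0.
have qq : q <= q0 / 2 by rewrite !ge_min lexx !orbT.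
exists q, K, r1, C; split => //.
- by rewrite !lt_min ltr01 p00 divr_gt0 //= ge_min lexx.
- by rewrite r10 r11.
- split => //.
  + exists N; split => // x /= /not_implyP[xd xq]; apply: SN => /= h; apply: xq.
    have /h/andP[h1 h2] : closed_disc (cplx x) by exact: ltW.
    by rewrite le_max /b; apply/andP; split; [lra|apply/orP; left; lra].
  + move=> r rr; exists E; split => // t /= /not_implyP[t02 ht]; split => //.
    apply/Gpolar => hab; apply: ht.
    have rp : 0 < r by move: rr; lra.
    have rr' : r1 <= modulus (polar r t) < 1 by rewrite modulus_polar // ltW.
    have := close _ rr'; rewrite modulus_polar ?(ltW rp) // radial_exponent_polar //.
    move=> /le_trans/(_ (small _ rr)); rewrite ler_norml.
    by move: hab qq; rewrite /a; lra.
- split.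
  + exact: measurable_radial_exponent.
  + exact: radial_exponent_gt0.
  + exists [set x | (modulus (cplx x) \in `]0, 1[) /\ G (direction x)]; split => //.
      apply: measurableI; first exact: measurable_modulus_itv.
      by rewrite -[X in measurable X]setTI; exact: measurable_direction.
    move=> x /= /not_implyP[xd xq].
    have [x0|x0] := eqVneq (cplx x) 0.
      exfalso; apply: xq; rewrite /radial_exponent x0 normr0 invr0 mulr0.
      by rewrite !ge_min le_max lexx !orbT.
    have mx0 : 0 < modulus (cplx x).
      rewrite lt_neqAle modulus_ge0 andbT eq_sym; apply: contra x0 => /eqP m0.
      by apply/eqP; exact: ComplexField.Normc.eq0_normc m0.
    rewrite in_itv /= mx0; split => //; split.
      by change (closed_disc (cplx (direction x))); rewrite cplx_direction; exact: closed_disc_unit.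
    rewrite /= cplx_direction -/(radial_exponent p (cplx x)) in_itv /= => hab.
    apply: xq; rewrite le_max.
    by move: hab qq; rewrite /a /b => /andP[h1 h2] qq; apply/andP; split;
      [lra|apply/orP; left].
  + move=> r rr; exists E; split => // t /= /not_implyP[t02 ht]; split => //.
    apply/Gpolar => hab; apply: ht; rewrite radial_exponent_polar; last by move: rr; lra.
    by move: hab qq; rewrite /a; lra.
Qed.

End exponents.

(** * Changing the exponent, and finiteness of integrals *)

Section change_of_exponent.
Variable R : realType.

Lemma powR_le1 (y p : R) : 0 <= y <= 1 -> 0 <= p -> y `^ p <= 1.
Proof.
move=> /andP[y0 y1] p0; have <- : 1 `^ p = 1 :> R by rewrite powR1.
exact: ler_powR_base.
Qed.

(** For [s^(1/q) <= y <= K s^(- N)] the logarithm of [y] is [O(- ln s)], and a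
    change of the exponent by [O(1 / - ln s)] costs only a bounded factor; for
    [y <= s^(1/q)] the power is at most [s]. The summand [s] rather than [1] is
    what the weights [s^alpha] with [alpha < 0] require. *)
Lemma change_exponent (q K N C l0 y s p1 p2 : R) :
  0 < q -> 0 <= N -> 0 < l0 -> 0 < s < 1 -> l0 <= - ln s ->
  0 < K -> 0 <= y <= K * s `^ (- N) -> q <= p2 -> `|p1 - p2| <= C / - ln s ->
  y `^ p2 <= s + expR (C * (`|ln K| / l0 + N + q^-1)) * y `^ p1.
Proof.
move=> q0 N0 l00 /andP[s0 s1] sl K0 /andP[y0 yK] qp pp.
have l1 : 0 < - ln s by exact: lt_le_trans sl.
have [ys|sy] := leP y (s `^ q^-1).
  apply: (@le_trans _ _ s); last by rewrite lerDl mulr_ge0 ?expR_ge0 ?powR_ge0.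
  have p20 : 0 <= p2 by rewrite (le_trans _ qp) // ltW.
  apply: le_trans (ler_powR_base p20 y0 ys) _; rewrite -powRrM.
  rewrite -[leRHS](powRr1 (ltW s0)); apply: ger_powR; first by rewrite s0 ltW.
  by rewrite mulrC ler_pdivlMr // mul1r.
have yp : 0 < y by apply: lt_trans sy; exact: powR_gt0.
rewrite -[leLHS]add0r; apply: lerD; first exact: ltW.
rewrite /powR !gt_eqF // -expRD ler_expR.
have C0 : 0 <= C / - ln s by exact: le_trans pp.
have C1 : 0 <= C by move: C0; rewrite ler_pdivlMr // mul0r.
have lny1 : ln y <= `|ln K| + N * - ln s.
  have : ln y <= ln (K * s `^ (- N)) by rewrite ler_ln ?posrE // mulr_gt0 // powR_gt0.
  rewrite lnM ?posrE ?powR_gt0 // ln_powR => h; apply: le_trans h _.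
  by rewrite mulrN mulNr lerD2r ler_norm.
have lny2 : - (q^-1 * - ln s) <= ln y.
  have : ln (s `^ q^-1) <= ln y by rewrite ler_ln ?posrE ?powR_gt0 // ltW.
  by rewrite ln_powR mulrN opprK.
have qi : 0 < q^-1 by rewrite invr_gt0.
pose W := `|ln K| + (N + q^-1) * - ln s.
have lnyW : `|ln y| <= W.
  have k0 := normr_ge0 (ln K).
  have := mulr_ge0 N0 (ltW l1); have := mulr_gt0 qi l1.
  by rewrite ler_norml /W mulrDl; lra.
have W0 : 0 <= W by exact: le_trans lnyW.
have h1 : (p2 - p1) * ln y <= C / - ln s * W.
  apply: le_trans (ler_norm _) _; rewrite normrM distrC; exact: ler_pM.
have h2 : C / - ln s * W <= C * (`|ln K| / l0 + N + q^-1).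
  rewrite /W -mulrA; apply: ler_wpM2l => //.
  rewrite mulrDr [_ * - ln s]mulrC mulKf ?gt_eqF // addrA !lerD2r mulrC.
  by apply: ler_wpM2l => //; rewrite lef_pV2.
by move: (le_trans h1 h2); rewrite mulrBl; lra.
Qed.

End change_of_exponent.

Section finite_integrals.
Local Open Scope ereal_scope.
Context d (T : measurableType d) (R : realType).
Variable m : {measure set T -> \bar R}.

(** Monotonicity for functions that are not known to be measurable, such as the
    circular means of a function on the plane. *)
Lemma ge0_le_integralT (f g : T -> \bar R) :
  (forall x, 0 <= f x) -> (forall x, f x <= g x) ->
  \int[m]_x f x <= \int[m]_x g x.
Proof.
move=> f0 fg; have g0 x : 0 <= g x by exact: le_trans (fg x).
rewrite !ge0_integralTE //; apply: le_ereal_sup => _ [h hf <-].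
by exists h => // x; exact: le_trans (fg x).
Qed.

Lemma le_integral_affine (D : set T) (v w : T -> R) (M c : R) :
  measurable D -> measurable_fun D v -> measurable_fun D w ->
  (forall x, D x -> (0 <= v x)%R) -> (forall x, D x -> (0 <= w x)%R) ->
  (0 <= M)%R -> (0 <= c)%R ->
  {ae m, forall x, D x -> (v x <= M + c * w x)%R} ->
  \int[m]_(x in D) (v x)%:E <= M%:E * m D + c%:E * \int[m]_(x in D) (w x)%:E.
Proof.
move=> mD mv mw v0 w0 M0 c0 vw.
apply: (@le_trans _ _ (\int[m]_(x in D) (M%:E + c%:E * (w x)%:E))).
  apply: ae_ge0_le_integral => //.
  - exact/measurable_EFinP.
  - by move=> x Dx; rewrite -EFinM -EFinD lee_fin addr_ge0 // mulr_ge0 // w0.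
  - by apply: emeasurable_funD => //; apply: measurable_funeM; exact/measurable_EFinP.
rewrite ge0_integralD //.
- rewrite integral_cst // ge0_integralZl_EFin //.
  exact/measurable_EFinP.
- by move=> x Dx; rewrite -EFinM lee_fin mulr_ge0 // w0.
- by apply: measurable_funeM; exact/measurable_EFinP.
Qed.

Lemma integral_affine_lty (D : set T) (v w : T -> R) (M c : R) :
  measurable D -> m D < +oo -> measurable_fun D v -> measurable_fun D w ->
  (forall x, D x -> (0 <= v x)%R) -> (forall x, D x -> (0 <= w x)%R) ->
  (0 <= M)%R -> (0 <= c)%R ->
  {ae m, forall x, D x -> (v x <= M + c * w x)%R} ->
  \int[m]_(x in D) (w x)%:E < +oo -> \int[m]_(x in D) (v x)%:E < +oo.
Proof.
move=> mD Doo mv mw v0 w0 M0 c0 vw woo.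
apply: le_lt_trans (le_integral_affine mD mv mw v0 w0 M0 c0 vw) _.
by rewrite lte_add_pinfty // lte_mul_pinfty.
Qed.

(** A gap [1 - v] that is positive at every point, even without a positive lower
    bound, has a positive integral. *)
Lemma integral_lt_measure (D : set T) (v : T -> R) :
  measurable D -> 0 < m D < +oo -> measurable_fun D v ->
  (forall x, D x -> (0 <= v x < 1)%R) -> \int[m]_(x in D) (v x)%:E < m D.
Proof.
move=> mD /andP[D0 Doo] mv v01; rewrite ltNge; apply/negP => h.
have mw : measurable_fun D (fun x => 1 - v x)%R by exact: measurable_funB.
have v0 x : D x -> 0 <= (v x)%:E by move=> /v01/andP[]; rewrite lee_fin.
have w0 x : D x -> 0 <= (1 - v x)%:E.
  by move=> /v01/andP[_ /ltW]; rewrite lee_fin subr_ge0.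
have sumE : \int[m]_(x in D) (v x)%:E + \int[m]_(x in D) (1 - v x)%:E = m D.
  rewrite -ge0_integralD //; try exact/measurable_EFinP.
  under eq_integral do rewrite -EFinD addrC subrK.
  by rewrite integral_cst // mul1e.
have i0 : 0 <= \int[m]_(x in D) (1 - v x)%:E by exact: integral_ge0.
have Dfin : m D \is a fin_num by rewrite ge0_fin_numE.
have w00 : \int[m]_(x in D) (1 - v x)%:E = 0.
  apply/eqP; rewrite eq_le i0 andbT -(@leeD2lE _ (m D)) // adde0 -[leRHS]sumE.
  by rewrite leeD2r.
have : \int[m]_(x in D) `|(1 - v x)%:E| = 0.
  rewrite -[RHS]w00; apply: eq_integral => x /set_mem Dx.
  by rewrite gee0_abs // w0.
move/ae_eq_integral_abs => /(_ mD) []; first exact/measurable_EFinP.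
move=> N [mN N0 SN].
have : m D <= m N.
  apply: le_measure; rewrite ?inE // => x Dx; apply: SN => /= /(_ Dx) [] e.
  by have /andP[_] := v01 _ Dx; rewrite ltNge -subr_le0 e lexx.
by rewrite N0 leNgt D0.
Qed.

End finite_integrals.

(** * Comparison of Bergman spaces *)

Section comparison.
Variable R : realType.
Local Notation mu := (@lebesgue_measure R).
Local Notation plane := (measurableTypeR R * measurableTypeR R)%type.
Local Notation mu2 := (mu \x mu)%E.
Local Notation D := (@cplx R @^-1` @disc R).
Implicit Types (z : R[i]) (p : R[i] -> R) (f : R[i] -> R[i]).

Lemma disc_area_lty : (mu2 D < +oo)%E.
Proof.
have [_ h] := andP (disc_area_bounds (@ltr01 R)).
have mC : measurable [set x : plane | modulus (cplx x) <= 1].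
  have := measurable_modulus_itv `]-oo, (1 : R)].
  by congr measurable; apply/seteqP; split => x /=; rewrite in_itv.
apply: le_lt_trans h; apply: le_measure; rewrite ?inE //; first exact: measurable_disc.
by move=> x; exact: ltW.
Qed.

(** Areas are normalized by the factor [1 / pi], which does not affect
    finiteness. *)
Lemma integral_area_lty (h : plane -> \bar R) : measurable_fun D h ->
  (forall x, D x -> 0 <= h x)%E ->
  (\int[area R]_(x in D) h x < +oo)%E <-> (\int[mu2]_(x in D) h x < +oo)%E.
Proof.
move=> mh h0; rewrite ge0_integral_mscale //; last exact: measurable_disc.
have pi1 : 0 < pi^-1 :> R by rewrite invr_gt0 pi_gt0.
have i0 : (0 <= \int[mu2]_(x in D) h x)%E by exact: integral_ge0.
split => [|oo]; last by rewrite /= lte_mul_pinfty // ltW.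
case: (\int[mu2]_(x in D) h x)%E i0 => [r _ _||//]; first exact: ltry.
by rewrite /= mulry gtr0_sg // mul1e.
Qed.

Lemma measurable_power f p : analytic_on_disc f ->
  measurable_fun (@cplx R @^-1` @closed_disc R) (p \o @cplx R) ->
  (forall z, closed_disc z -> 0 < p z) ->
  measurable_fun D (fun x : plane => modulus (f (cplx x)) `^ p (cplx x)).
Proof.
move=> fa mp p0; apply: measurable_fun_powR.
- exact: measurable_disc.
- exact: measurable_analytic.
- apply: measurable_funS mp; first exact: measurable_closed_disc.
  by move=> x; exact: ltW.
- by move=> x xd; rewrite modulus_ge0 gt_eqF // p0 // /closed_disc; exact: ltW.
Qed.

Section two_exponents.
Variables (q K r1 C : R) (p1 p2 : R[i] -> R).
Hypothesis q01 : 0 < q <= 1.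
Hypothesis r101 : 0 < r1 < 1.
Hypothesis close : log_close r1 C p1 p2.
Hypothesis tame1 : tame_exponent q K r1 p1.
Hypothesis tame2 : tame_exponent q K r1 p2.

Let q0 : 0 < q. Proof. by case/andP: q01. Qed.
Let r10 : 0 < r1. Proof. by case/andP: r101. Qed.
Let r11 : r1 < 1. Proof. by case/andP: r101. Qed.

Let pos (p : R[i] -> R) : tame_exponent q K r1 p ->
  forall z, disc z -> 0 < p z.
Proof. by move=> tp z zd; apply: (tame_gt0 tp); exact: ltW. Qed.

Lemma power_le_annulus (y : R[i] -> R) (A N : R) : 0 < A -> 0 <= N ->
  (forall z, disc z -> 0 <= y z <= A * (1 - modulus z) `^ (- N)) ->
  exists2 L, 0 <= L & forall z, r1 <= modulus z < 1 -> q <= p2 z ->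
    y z `^ p2 z <= (1 - modulus z) + L * y z `^ p1 z.
Proof.
move=> A0 N0 yA.
have l0 : 0 < - ln (1 - r1).
  by rewrite oppr_gt0 ln_lt0 //; apply/andP; split; have := r10; have := r11; lra.
exists (expR (C * (`|ln A| / - ln (1 - r1) + N + q^-1))); first exact: expR_ge0.
move=> z zr qz; have /andP[rz z1] := zr; have r1p := r10.
apply: (@change_exponent _ q A N C (- ln (1 - r1))) => //.
- by apply/andP; split; lra.
- by rewrite lerN2 ler_ln ?posrE; lra.
- exact: yA.
- exact: close.
Qed.

(** [|f|^q <= 1 + |f|^p1] almost everywhere, and the weight with
    [beta = max alpha 0] is at most both [1] and the weight with [alpha]. *)
Lemma bergman_growth (alpha : R) f : -1 < alpha -> bergman_space p1 alpha f ->
  exists A N : R, [/\ 0 < A, 0 <= N &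
    forall z, disc z -> modulus (f z) <= A * (1 - modulus z) `^ (- N)].
Proof.
move=> a1 [fa foo]; pose beta := Num.max alpha 0.
have mD := @measurable_disc R.
have ap : 0 < alpha + 1 by lra.
have mw : measurable_fun D (fun x : plane => modulus (f (cplx x)) `^ p1 (cplx x) *
    ((alpha + 1) * (1 - modulus (cplx x) ^+ 2) `^ alpha)).
  apply: measurable_funM.
    by apply: measurable_power => //; [exact: tame_measurable tame1|exact: tame_gt0 tame1].
  by apply: measurable_funM => //; exact: measurable_weight.
have w0 (x : plane) : D x -> 0 <= modulus (f (cplx x)) `^ p1 (cplx x) *
    ((alpha + 1) * (1 - modulus (cplx x) ^+ 2) `^ alpha).
  by move=> _; rewrite !mulr_ge0 ?powR_ge0 // ltW.
have b0 : 0 <= beta by rewrite le_max lexx orbT.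
apply: (@growth_estimate _ f q beta) => //.
apply: (@integral_affine_lty _ _ _ mu2 D _ _ 1 (alpha + 1)^-1 mD disc_area_lty _ mw) => //.
- apply: measurable_funM; last exact: measurable_weight.
  apply: (@measurableT_comp _ _ _ _ _ _ (fun t : R => t `^ q)).
    exact: measurable_powR.
  exact: measurable_analytic.
- by move=> x _; rewrite mulr_ge0 ?powR_ge0.
- by rewrite invr_ge0 ltW.
- apply: filterS (tame_disc tame1) => x qK xd; have /andP[qp _] := qK xd.
  set y := modulus (f (cplx x)); set s := 1 - modulus (cplx x) ^+ 2.
  have y0 : 0 <= y by exact: modulus_ge0.
  have m1 : modulus (cplx x) < 1 by [].
  have m0 := modulus_ge0 (cplx x).
  have s0 : 0 < s by rewrite subr_gt0 expr_lt1.
  have s1 : s <= 1 by rewrite gerBl sqr_ge0.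
  have -> : (alpha + 1)^-1 * (y `^ p1 (cplx x) * ((alpha + 1) * s `^ alpha)) =
     y `^ p1 (cplx x) * s `^ alpha by field; rewrite gt_eqF.
  have sb1 : s `^ beta <= 1 by apply: powR_le1 => //; rewrite s1 ltW.
  have sba : s `^ beta <= s `^ alpha.
    by apply: ger_powR; [rewrite s0 s1|rewrite le_max lexx].
  have [y1|y1] := leP y 1.
    have h : y `^ q <= 1 by apply: powR_le1; [rewrite y0 y1|exact: ltW q0].
    apply: (@le_trans _ _ 1); last by rewrite lerDl mulr_ge0 ?powR_ge0.
    by rewrite -[leRHS]mulr1; apply: ler_pM => //; exact: powR_ge0.
  apply: (@le_trans _ _ (y `^ p1 (cplx x) * s `^ alpha)); last by rewrite lerDr.
  apply: ler_pM => //; rewrite ?powR_ge0 //.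
  by apply: ler_powR => //; exact: ltW.
- by apply/(integral_area_lty _ _) => //; exact/measurable_EFinP.
Qed.

(** Near the boundary [change_exponent] applies; its summand [1 - |z|] offsets
    the weight. In the rest of the disc [f], the weight and almost everywhere
    the exponent are bounded. *)
Lemma bergman_subset (alpha : R) : -1 < alpha ->
  bergman_space p1 alpha `<=` bergman_space p2 alpha.
Proof.
move=> a1 f ff; have [A [N [A0 N0 fA]]] := bergman_growth a1 ff.
move: ff => [fa foo]; split => //.
have mD := @measurable_disc R.
have ap : 0 < alpha + 1 by lra.
have [|L L0 HL] := @power_le_annulus (fun z => modulus (f z)) A N A0 N0.
  by move=> z zd; rewrite modulus_ge0 fA.
have [B B0 HB] := analytic_bounded fa r11.
have mw p : tame_exponent q K r1 p ->
    measurable_fun D (fun x : plane => modulus (f (cplx x)) `^ p (cplx x) *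
    ((alpha + 1) * (1 - modulus (cplx x) ^+ 2) `^ alpha)).
  move=> tp; apply: measurable_funM.
    by apply: measurable_power => //; [exact: tame_measurable tp|exact: tame_gt0 tp].
  by apply: measurable_funM => //; exact: measurable_weight.
have w0 p (x : plane) : D x -> 0 <= modulus (f (cplx x)) `^ p (cplx x) *
    ((alpha + 1) * (1 - modulus (cplx x) ^+ 2) `^ alpha).
  by move=> _; rewrite !mulr_ge0 ?powR_ge0 // ltW.
have w0e p (x : plane) : D x -> (0 <= (modulus (f (cplx x)) `^ p (cplx x) *
    ((alpha + 1) * (1 - modulus (cplx x) ^+ 2) `^ alpha))%:E)%E.
  by move=> xd; rewrite lee_fin; exact: w0.
apply/(integral_area_lty _ (w0e p2)); first by apply/measurable_EFinP; exact: mw.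
have foo' : (\int[mu2]_(x in D) (modulus (f (cplx x)) `^ p1 (cplx x) *
    ((alpha + 1) * (1 - modulus (cplx x) ^+ 2) `^ alpha))%:E < +oo)%E.
  by apply/(integral_area_lty _ (w0e p1)) => //; apply/measurable_EFinP; exact: mw.
pose M := (alpha + 1) + (1 + B) `^ K * ((alpha + 1) * (1 + (1 - r1 ^+ 2) `^ alpha)).
have M0 : 0 <= (1 + B) `^ K * ((alpha + 1) * (1 + (1 - r1 ^+ 2) `^ alpha)).
  apply: mulr_ge0; first exact: powR_ge0.
  by apply: mulr_ge0; [exact: ltW|rewrite addr_ge0 // powR_ge0].
apply: (@integral_affine_lty _ _ _ mu2 D _ _ M L mD disc_area_lty (mw _ tame2) (mw _ tame1)) => //.
- by move=> x; exact: w0.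
- by move=> x; exact: w0.
- by rewrite addr_ge0 // ltW.
apply: filterS (tame_disc tame2) => x qK xd; have /andP[qp pK] := qK xd.
set y := modulus (f (cplx x)); set s := 1 - modulus (cplx x) ^+ 2.
have y0 : 0 <= y by exact: modulus_ge0.
have m1 : modulus (cplx x) < 1 by [].
have m0 := modulus_ge0 (cplx x).
have s0 : 0 < s by rewrite subr_gt0 expr_lt1.
have s1 : s <= 1 by rewrite gerBl sqr_ge0.
have sa0 : 0 <= s `^ alpha by exact: powR_ge0.
have w10 : 0 <= y `^ p1 (cplx x) * ((alpha + 1) * s `^ alpha) by exact: w0.
have [rx|xr] := leP r1 (modulus (cplx x)).
  have xr : r1 <= modulus (cplx x) < 1 by rewrite rx.
  have := HL _ xr qp; rewrite -/y => h.
  have ms : 1 - modulus (cplx x) <= s.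
    by rewrite lerB // expr2 ler_piMl // ltW.
  (* [alpha + 1 > 0]. *)
  have sas : s * s `^ alpha <= 1.
    rewrite -{1}(powRr1 (ltW s0)) -powRD ?(gt_eqF s0) ?implybT //.
    by apply: powR_le1; [rewrite s1 ltW|lra].
  apply: (@le_trans _ _ ((s + L * y `^ p1 (cplx x)) * ((alpha + 1) * s `^ alpha))).
    apply: ler_wpM2r; first by rewrite mulr_ge0 // ltW.
    by apply: le_trans h _; rewrite lerD2r.
  have -> : (s + L * y `^ p1 (cplx x)) * ((alpha + 1) * s `^ alpha) =
    (alpha + 1) * (s * s `^ alpha) +
    L * (y `^ p1 (cplx x) * ((alpha + 1) * s `^ alpha)) by ring.
  rewrite lerD2r; apply: (@le_trans _ _ (alpha + 1)); last by rewrite lerDl.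
  by rewrite ler_piMr // ltW.
have y1B : y <= 1 + B.
  by apply: (@le_trans _ _ B); [apply: HB; exact: ltW|rewrite lerDr].
have p20 : 0 <= p2 (cplx x) by apply: ltW; exact: pos tame2 _ xd.
have yB : y `^ p2 (cplx x) <= (1 + B) `^ K.
  apply: le_trans (ler_powR_base p20 y0 y1B) _.
  by apply: ler_powR => //; rewrite lerDl.
have rs : 1 - r1 ^+ 2 <= s by rewrite lerB // lerXn2r ?nnegrE // ltW // r10.
have r12 : 0 < 1 - r1 ^+ 2 by rewrite subr_gt0 expr_lt1 // ltW.
have sa : s `^ alpha <= 1 + (1 - r1 ^+ 2) `^ alpha.
  have [al0|al0] := leP 0 alpha.
    apply: (@le_trans _ _ 1); last by rewrite lerDl powR_ge0.
    by apply: powR_le1 => //; rewrite s1 ltW.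
  apply: (@le_trans _ _ ((1 - r1 ^+ 2) `^ alpha)); last by rewrite lerDr.
  rewrite -[alpha]opprK ![_ `^ (- - _)]powRN lef_pV2 ?posrE ?powR_gt0 //.
  by apply: ler_powR_base => //; [rewrite oppr_ge0 ltW|exact: ltW].
rewrite /M -addrA; apply: (@le_trans _ _ ((1 + B) `^ K * ((alpha + 1) * (1 + (1 - r1 ^+ 2) `^ alpha)))).
  apply: ler_pM => //; rewrite ?powR_ge0 ?mulr_ge0 ?(ltW ap) //.
  by rewrite ler_pM2l.
by rewrite addrCA lerDl; apply: addr_ge0; [exact: ltW|exact: mulr_ge0].
Qed.

End two_exponents.
End comparison.

(** * Comparison of Hardy spaces *)

Section circular_means.
Variable R : realType.
Local Notation mu := (@lebesgue_measure R).
Local Notation plane := (measurableTypeR R * measurableTypeR R)%type.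
Local Notation mu2 := (mu \x mu)%E.
Local Notation D := (@cplx R @^-1` @disc R).
Local Notation circle := (`[0%R, (2 * pi)%R]%classic : set R).
Implicit Types (z : R[i]) (p : R[i] -> R) (f : R[i] -> R[i]).

Lemma mu_circle : mu circle = (2 * pi)%:E.
Proof.
rewrite lebesgue_measure_itv /= lte_fin mulr_gt0 ?pi_gt0 //.
by rewrite oppr0 adde0.
Qed.

Definition power_integral p (r l : R) f : \bar R :=
  (\int[mu]_(t in circle) ((modulus (f (polar r t)) / l) `^ p (polar r t))%:E)%E.

Lemma disc_polar (r t : R) : 0 <= r < 1 -> disc (polar r t).
Proof. by move=> /andP[r0 r1]; rewrite /disc /mkset modulus_polar. Qed.

Lemma measurable_circle_power f p (r l : R) : analytic_on_disc f ->
  measurable_fun (@cplx R @^-1` @closed_disc R) (p \o @cplx R) ->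
  (forall z, closed_disc z -> 0 < p z) -> 0 < l -> 0 <= r < 1 ->
  measurable_fun circle (fun t => (modulus (f (polar r t)) / l) `^ p (polar r t)).
Proof.
move=> fa mp p0 l0 r01.
have mc := measurable_funTS (D := circle) (measurable_circle r).
have sub (A : set R[i]) : (forall t, A (polar r t)) ->
    ((fun t : R => (r * cos t, r * sin t) : plane) @` circle `<=` @cplx R @^-1` A).
  by move=> At _ [t _ <-]; change (A (cplx ((r * cos t, r * sin t) : plane))); rewrite polarE.
apply: measurable_fun_powR; first exact: measurable_itv.
- apply: measurable_funM => //.
  have -> : (fun t => modulus (f (polar r t))) =
      (fun x : plane => modulus (f (cplx x))) \o (fun t : R => (r * cos t, r * sin t) : plane).
    by apply/funext => t /=; rewrite polarE.
  apply: measurable_comp (measurable_analytic fa) mc; first exact: measurable_disc.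
  by apply: sub => t; exact: disc_polar.
- have -> : (fun t => p (polar r t)) =
      (p \o @cplx R) \o (fun t : R => (r * cos t, r * sin t) : plane).
    by apply/funext => t /=; rewrite polarE.
  apply: measurable_comp mp mc; first exact: measurable_closed_disc.
  by apply: sub => t; apply: ltW; exact: disc_polar.
move=> t _; rewrite divr_ge0 ?modulus_ge0 ?(ltW l0) // gt_eqF // p0 //.
by apply: ltW; exact: disc_polar.
Qed.

Lemma hardy_integralE p (r l : R) f : 0 < l ->
  (\int[mu]_(t in circle) (modulus (f (polar r t) / l%:C) `^ p (polar r t))%:E =
   power_integral p r l f)%E.
Proof.
move=> l0; apply: eq_integral => t _.
have -> : modulus (f (polar r t) / l%:C) = modulus (f (polar r t)) / l; last by [].
by rewrite (modulusM (f (polar r t))) (modulusV l%:C) (modulusR l) gtr0_norm.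
Qed.

Lemma hardy_mean_le p (r l : R) f : 0 < l ->
  (power_integral p r l f < (2 * pi)%:E)%E -> (hardy_mean p r f <= l%:E)%E.
Proof.
move=> l0 h; apply: ereal_inf_lbound; exists l => //; split => //.
rewrite hardy_integralE //.
have pi0 : 0 < 2 * pi :> R by rewrite mulr_gt0 ?pi_gt0.
have I0 : (0 <= power_integral p r l f)%E.
  by apply: integral_ge0 => t _; rewrite lee_fin powR_ge0.
move: h I0; case: (power_integral p r l f) => [x|//|//]; rewrite lte_fin lee_fin => h _.
by rewrite -EFinM lte_fin mulrC ltr_pdivrMr // mul1r.
Qed.

(** The means are infima; since the integrals decrease with [l], one [l] above
    all of the means is admissible on all circles. *)
Lemma hardy_space_scale p f : hardy_space p f ->
  measurable_fun (@cplx R @^-1` @closed_disc R) (p \o @cplx R) ->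
  (forall z, closed_disc z -> 0 < p z) ->
  exists2 l : R, 0 < l & forall r, 0 <= r < 1 -> (power_integral p r l f < (2 * pi)%:E)%E.
Proof.
move=> [fa]; set S := ereal_sup _ => Soo mp p0.
pose l := Num.max 1 (fine S + 1).
have l0 : 0 < l by rewrite lt_max ltr01.
have Sl : (S < l%:E)%E.
  have above (T : \bar R) : (T < +oo)%E -> (T < (Num.max 1 (fine T + 1))%:E)%E.
    case: T => [x _|//|_]; last exact: ltNyr.
    by rewrite lte_fin lt_max /= ltrDl ltr01 orbT.
  exact: above.
exists l => // r r01.
have : (hardy_mean p r f < l%:E)%E.
  by apply: le_lt_trans Sl; apply: ereal_sup_ubound; exists r.
move=> /ereal_inf_lt[_ [l' [l'0 h] <-]]; rewrite lte_fin => ll'.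
rewrite hardy_integralE // in h.
have pi0 : 0 < 2 * pi :> R by rewrite mulr_gt0 ?pi_gt0.
apply: (@le_lt_trans _ _ (power_integral p r l' f)).
  apply: ge0_le_integral => //.
  - by move=> t _; rewrite lee_fin powR_ge0.
  - by apply/measurable_EFinP; exact: measurable_circle_power.
  - by apply/measurable_EFinP; exact: measurable_circle_power.
  move=> t _; rewrite lee_fin; apply: ler_powR_base.
  - by apply/ltW/p0/ltW; exact: disc_polar.
  - by rewrite divr_ge0 ?modulus_ge0 // ltW.
  by apply: ler_wpM2l; [exact: modulus_ge0|rewrite lef_pV2 // ltW].
have I0 : (0 <= power_integral p r l' f)%E.
  by apply: integral_ge0 => t _; rewrite lee_fin powR_ge0.
move: h I0; case: (power_integral p r l' f) => [x| |//].
  by rewrite -EFinM !lte_fin mulrC ltr_pdivrMr // mul1r.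
by rewrite mulry gtr0_sg ?invr_gt0 // mul1e.
Qed.

(** On a circle away from the boundary [p] may be unbounded and may approach
    [0], but [|f / l| < 1] there for [l] large, and then the power is less
    than [1] at every point. *)
Lemma hardy_mean_small_circles p f (r1 : R) : analytic_on_disc f ->
  measurable_fun (@cplx R @^-1` @closed_disc R) (p \o @cplx R) ->
  (forall z, closed_disc z -> 0 < p z) -> r1 < 1 ->
  exists l : R, forall r, 0 <= r <= r1 -> (hardy_mean p r f <= l%:E)%E.
Proof.
move=> fa mp p0 r11; have [B B0 HB] := analytic_bounded fa r11.
have l0 : 0 < B + 1 by rewrite ltr_wpDl.
exists (B + 1) => r /andP[r0 rr].
have r01 : 0 <= r < 1 by rewrite r0 (le_lt_trans rr).
have mc : (0 < mu circle < +oo)%E.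
  by rewrite mu_circle lte_fin mulr_gt0 ?pi_gt0 //= ltry.
apply: hardy_mean_le => //; rewrite -mu_circle.
apply: integral_lt_measure.
- exact: measurable_itv.
- exact: mc.
- exact: measurable_circle_power.
move=> t _; rewrite powR_ge0 /=.
have m0 := modulus_ge0 (f (polar r t)).
have y1 : modulus (f (polar r t)) / (B + 1) < 1.
  rewrite ltr_pdivrMr // mul1r; apply: (@le_lt_trans _ _ B); last by rewrite ltrDl.
  by apply: HB; rewrite modulus_polar.
have p1 : 0 < p (polar r t) by apply/p0/ltW; exact: disc_polar.
have one : 1 `^ p (polar r t) = 1 by rewrite powR1.
rewrite -[ltRHS]one; apply: gt0_ltr_powR => //; rewrite ?nnegrE //.
by rewrite divr_ge0 // ltW.
Qed.

End circular_means.

Section hardy_comparison.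
Variable R : realType.
Local Notation mu := (@lebesgue_measure R).
Local Notation plane := (measurableTypeR R * measurableTypeR R)%type.
Local Notation mu2 := (mu \x mu)%E.
Local Notation D := (@cplx R @^-1` @disc R).
Local Notation circle := (`[0%R, (2 * pi)%R]%classic : set R).
Variables (q K r1 C : R) (p1 p2 : R[i] -> R).
Hypothesis q01 : 0 < q <= 1.
Hypothesis r101 : 0 < r1 < 1.
Hypothesis close : log_close r1 C p1 p2.
Hypothesis tame1 : tame_exponent q K r1 p1.
Hypothesis tame2 : tame_exponent q K r1 p2.

Let q0 : 0 < q. Proof. by case/andP: q01. Qed.
Let r11 : r1 < 1. Proof. by case/andP: r101. Qed.

(** [|f / l|^q <= 1 + |f / l|^p1] on almost all of each circle near the
    boundary, so the circular means of [|f / l|^q] are at most [4 pi] and its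
    integral over the annulus is finite. *)
Lemma hardy_growth f : hardy_space p1 f -> exists A N : R, [/\ 0 < A, 0 <= N &
    forall z, disc z -> modulus (f z) <= A * (1 - modulus z) `^ (- N)].
Proof.
move=> hf; have mp := tame_measurable tame1; have p0 := tame_gt0 tame1.
have [l l0 Hl] := hardy_space_scale hf mp p0; case: hf => fa _.
have mD := @measurable_disc R.
have [B B0 HB] := analytic_bounded fa r11.
have pi0 : 0 < 2 * pi :> R by rewrite mulr_gt0 ?pi_gt0.
pose Q : set plane := [set x | modulus (cplx x) \in `[r1, 1[].
have mQ : measurable Q by exact: measurable_modulus_itv.
have QD : Q `<=` D by move=> x; rewrite /Q /= in_itv => /andP[].
pose v (x : plane) := (modulus (f (cplx x)) / l) `^ q.
have mv : measurable_fun D v.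
  apply: (@measurableT_comp _ _ _ _ _ _ (fun t : R => t `^ q)).
    exact: measurable_powR.
  by apply: measurable_funM => //; exact: measurable_analytic.
pose h := (EFin \o v) \_ Q.
have mh : measurable_fun setT h.
  apply/(measurable_restrictT _ mQ); apply/measurable_EFinP.
  exact: measurable_funS mv.
have h0 x : (0 <= h x)%E.
  by rewrite /h patchE; case: ifP => // _; rewrite lee_fin powR_ge0.
have hoo : (\int[mu2]_(x in Q) (v x)%:E < +oo)%E.
  have -> : (\int[mu2]_(x in Q) (v x)%:E = \int[mu2]_x h x)%E by rewrite integral_mkcond.
  suff : ((2 * pi)%:E * \int[mu2]_x h x < +oo)%E.
    have : (0 <= \int[mu2]_x h x)%E by exact: integral_ge0.
    case: (\int[mu2]_x h x)%E => [x _ _||//]; first exact: ltry.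
    by rewrite mulry gtr0_sg // mul1e.
  rewrite polar_integral //.
  apply: (@le_lt_trans _ _ (\int[mu2]_x ((2 * pi + 2 * pi) * \1_D x)%:E)%E); last first.
    under eq_integral do rewrite EFinM.
    rewrite ge0_integralZl_EFin ?addr_ge0 ?(ltW pi0) //; last first.
      exact/measurable_EFinP.
    by rewrite integral_indic // setIT lte_mul_pinfty ?lee_fin ?addr_ge0 ?(ltW pi0) // disc_area_lty.
  apply: ge0_le_integralT => x.
    by apply: integral_ge0 => t _; exact: h0.
  set r := modulus (cplx x).
  have rr : 0 <= r by exact: modulus_ge0.
  have mr t : modulus (cplx ((r * cos t, r * sin t) : plane)) = r.
    by rewrite polarE modulus_polar.
  have [rQ|rQ] := boolP (r \in `[r1, 1[); last first.
    rewrite integral0_eq ?lee_fin ?mulr_ge0 ?addr_ge0 ?(ltW pi0) //.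
    move=> t _; rewrite /h patchE ifF //; apply/negbTE; apply: contra rQ.
    by move=> /set_mem; rewrite /Q /mkset mr.
  have r01 : 0 <= r < 1 by move: rQ; rewrite in_itv /= rr => /andP[].
  rewrite indicE mem_set ?mulr1; last by have /andP[] := r01.
  apply: (@le_trans _ _ (\int[mu]_(t in circle) ((modulus (f (polar r t)) / l) `^ q)%:E)%E).
    rewrite le_eqVlt; apply/orP; left; apply/eqP; apply: eq_integral => t _.
    rewrite /h patchE mem_set; last by rewrite /Q /mkset mr.
    by rewrite /= /v polarE.
  have mpow : measurable_fun circle
      (fun t => (modulus (f (polar r t)) / l) `^ p1 (polar r t)).
    exact: measurable_circle_power.
  have mpq : measurable_fun circle (fun t => (modulus (f (polar r t)) / l) `^ q).
    apply: (@measurable_circle_power _ _ (fun=> q)) => //.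
    exact: measurable_cst.
  apply: (@le_trans _ _ (1%:E * mu circle + 1%:E * power_integral p1 r l f)%E).
    apply: le_integral_affine => //.
    - by move=> t _; exact: powR_ge0.
    - by move=> t _; exact: powR_ge0.
    have rQ' : r1 <= r < 1 by move: rQ; rewrite in_itv.
    apply: negligibleS (tame_circle tame1 rQ'); apply: subsetC => t qp t02.
    rewrite mul1r; set y := _ / l.
    have y0 : 0 <= y by rewrite divr_ge0 ?modulus_ge0 // ltW.
    have [y1|y1] := leP y 1.
      apply: (@le_trans _ _ 1); last by rewrite lerDl powR_ge0.
      by apply: powR_le1; [rewrite y0|exact: ltW q0].
    apply: (@le_trans _ _ (y `^ p1 (polar r t))); last by rewrite lerDr.
    by apply: ler_powR; [exact: ltW|exact: qp].
  rewrite !mul1e EFinD; apply: leeD; first by rewrite mu_circle.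
  by apply: ltW; exact: Hl.
apply: (@growth_estimate _ f q 0) => //.
rewrite -(setDUK QD).
have mu' (E : set plane) : E `<=` D -> measurable E ->
    measurable_fun E (fun x => (modulus (f (cplx x)) `^ q *
      (1 - modulus (cplx x) ^+ 2) `^ 0)%:E).
  move=> ED mE; apply/measurable_EFinP; apply: measurable_funS ED _ => //.
  apply: measurable_funM; last exact: measurable_weight.
  apply: (@measurableT_comp _ _ _ _ _ _ (fun t : R => t `^ q)).
    exact: measurable_powR.
  exact: measurable_analytic.
have mDQ : measurable (D `\` Q) by exact: measurableD.
have u0 (E : set plane) x : E x -> (0 <= (modulus (f (cplx x)) `^ q *
      (1 - modulus (cplx x) ^+ 2) `^ 0)%:E)%E.
  by move=> _; rewrite lee_fin mulr_ge0 ?powR_ge0.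
rewrite ge0_integral_setU //; last 3 first.
- by apply: mu'; [rewrite subUset; split => // x []|exact: measurableU].
- exact: u0.
- by rewrite disj_set2E; apply/eqP/seteqP; split => // x [Qx [_ nQx]]; exact: nQx.
apply: lte_add_pinfty.
  apply: (@le_lt_trans _ _ (\int[mu2]_(x in Q) ((l `^ q)%:E * (v x)%:E))%E).
    apply: ge0_le_integral => //.
    - exact: u0.
    - by apply: mu'.
    - by apply: measurable_funeM; apply/measurable_EFinP; exact: measurable_funS mv.
    move=> x _; rewrite -EFinM lee_fin powRr0 mulr1 /v -powRM ?(ltW l0) //.
      by rewrite mulrC divfK // gt_eqF.
    by rewrite divr_ge0 ?modulus_ge0 // ltW.
  rewrite ge0_integralZl_EFin ?powR_ge0 //.
  - by rewrite lte_mul_pinfty // lee_fin powR_ge0.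
  - by move=> x _; rewrite lee_fin powR_ge0.
  - by apply/measurable_EFinP; exact: measurable_funS mv.
apply: (@le_lt_trans _ _ (\int[mu2]_(x in D `\` Q) (B `^ q)%:E)%E).
  apply: ge0_le_integral => //; [exact: u0|by apply: mu' => // x []|].
  move=> x [xD xQ]; rewrite lee_fin powRr0 mulr1.
  apply: ler_powR_base => //; [exact: ltW q0|exact: modulus_ge0|apply: HB].
  by rewrite leNgt; apply/negP => rx; apply: xQ; rewrite /Q /= in_itv /= (ltW rx).
rewrite integral_cst // lte_mul_pinfty ?lee_fin ?powR_ge0 //.
by apply: le_lt_trans (@disc_area_lty R); apply: le_measure; rewrite ?inE // => x [].
Qed.

(** On circles near the boundary the integral grows at most by the factor
    [1 + L]; dividing [f / l] further by [m], where [m^q = 2 (1 + L)], brings it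
    below its bound again since the exponent is at least [q]. *)
Lemma hardy_subset : hardy_space p1 `<=` hardy_space p2.
Proof.
move=> f hf; have [A [N [A0 N0 fA]]] := hardy_growth hf.
have [l l0 Hl] := hardy_space_scale hf (tame_measurable tame1) (tame_gt0 tame1).
case: hf => fa _; split => //.
have mp := tame_measurable tame2; have p0 := tame_gt0 tame2.
have [l1 Hl1] := hardy_mean_small_circles fa mp p0 r11.
have Al0 : 0 < A / l by rewrite divr_gt0.
have [|L L0 HL] := @power_le_annulus _ q r1 C p1 p2 q01 r101 close
    (fun z => modulus (f z) / l) (A / l) N Al0 N0.
  move=> z zd; rewrite divr_ge0 ?modulus_ge0 ?(ltW l0) //=.
  by rewrite mulrAC ler_pM2r ?invr_gt0 // fA.
pose m := (2 * (1 + L)) `^ q^-1.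
have L1 : 1 <= 2 * (1 + L) by lra.
have m1 : 1 <= m.
  have one : 1 `^ q^-1 = 1 :> R by rewrite powR1.
  by rewrite -[leLHS]one; apply: ler_powR_base => //; rewrite invr_ge0 ltW // q0.
have mq : m `^ q = 2 * (1 + L).
  by rewrite -powRrM mulVf ?powRr1 ?gt_eqF // ?q0 // (le_trans _ L1).
have m0 : 0 < m by exact: lt_le_trans m1.
clearbody m; have lm0 : 0 < l * m by rewrite mulr_gt0.
have pi0 : 0 < 2 * pi :> R by rewrite mulr_gt0 ?pi_gt0.
apply: (@le_lt_trans _ _ (Num.max l1 (l * m))%:E); last exact: ltry.
apply: ge_ereal_sup => _ [r /= /andP[r0 r1'] <-].
have r01 : 0 <= r < 1 by rewrite r0.
have [rr|rr] := leP r r1.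
  apply: le_trans (Hl1 r _) _; first by rewrite r0.
  by rewrite lee_fin le_max lexx.
apply: (@le_trans _ _ (l * m)%:E); last by rewrite lee_fin le_max lexx orbT.
apply: hardy_mean_le => //.
have rr' : r1 <= r < 1 by rewrite (ltW rr).
have mpow p (l' : R) : tame_exponent q K r1 p -> 0 < l' -> measurable_fun circle
      (fun t => (modulus (f (polar r t)) / l') `^ p (polar r t)).
  by move=> tp l'0; apply: measurable_circle_power => //;
    [exact: tame_measurable tp|exact: tame_gt0 tp].
have c0 : 0 <= (m `^ q)^-1 by rewrite invr_ge0 powR_ge0.
have Lc0 : 0 <= L / m `^ q by rewrite mulr_ge0.
apply: (@le_lt_trans _ _ ((m `^ q)^-1%:E * mu circle +
    (L / m `^ q)%:E * power_integral p1 r l f)%E).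
  apply: le_integral_affine => //.
  - exact: mpow.
  - exact: mpow.
  - by move=> t _; exact: powR_ge0.
  - by move=> t _; exact: powR_ge0.
  apply: negligibleS (tame_circle tame2 rr'); apply: subsetC => t qp /qp{}qp.
  have mr : modulus (polar r t) = r by exact: modulus_polar.
  have := HL (polar r t); rewrite mr => /(_ rr' qp).
  set y := modulus _ / l => h.
  have y0 : 0 <= y by rewrite divr_ge0 ?modulus_ge0 // ltW.
  have -> : modulus (f (polar r t)) / (l * m) = y * m^-1.
    by rewrite /y invfM mulrA.
  rewrite powRM ?invr_ge0 ?(ltW m0) //.
  have -> : m^-1 `^ p2 (polar r t) = (m `^ p2 (polar r t))^-1.
    by rewrite -powR_inv1 ?(ltW m0) // -powRrM mulN1r powRN.
  apply: (@le_trans _ _ ((1 + L * y `^ p1 (polar r t)) / m `^ q)); last first.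
    by rewrite mulrDl mul1r mulrAC.
  apply: ler_pM => //; rewrite ?powR_ge0 ?invr_ge0 ?powR_ge0 //.
    by apply: le_trans h _; rewrite lerD2r gerBl.
  rewrite lef_pV2 ?posrE ?powR_gt0 //; exact: (ler_powR m1 qp).
have I0 : (0 <= power_integral p1 r l f)%E.
  by apply: integral_ge0 => t _; rewrite lee_fin powR_ge0.
have := Hl r r01; move: I0; case: (power_integral p1 r l f) => [x| |] //.
rewrite lee_fin lte_fin => x0 x2; rewrite mu_circle -!EFinM -EFinD lte_fin mq.
set c := 2 * (1 + L).
have -> : c^-1 * (2 * pi) + L / c * x = (2 * pi + L * x) / c by ring.
rewrite ltr_pdivrMr; last exact: lt_le_trans L1.
have : L * x <= L * (2 * pi) by apply: ler_wpM2l => //; exact: ltW.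
have : 0 <= L * (2 * pi) by rewrite mulr_ge0 // ltW.
have -> : 2 * pi * c = 2 * pi * 2 + (L * (2 * pi)) * 2 by rewrite /c; ring.
by move: pi0; lra.
Qed.

End hardy_comparison.

(** * The theorem *)

Unset Implicit Arguments.

Theorem theorem2p1 (R : realType) (alpha : R) (p : R[i] -> R) :
  -1 <= alpha ->
  variable_exponent p ->
  radially_log_holder p ->
  weighted_space p alpha = weighted_space (radial_exponent p) alpha.
Proof.
move=> a1 vp hp; rewrite /weighted_space.
have [q [K [r1 [C [q01 r101 close tame tame']]]]] := tame_exponents vp hp.
have close' := log_closeC close.
have [ae|an] := eqVneq alpha (-1).
  apply/seteqP; split; first exact: (hardy_subset q01 r101 close tame tame').
  exact: (hardy_subset q01 r101 close' tame' tame).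
have {}a1 : -1 < alpha by rewrite lt_neqAle eq_sym an.
apply/seteqP; split; first exact: (bergman_subset q01 r101 close tame tame').
exact: (bergman_subset q01 r101 close' tame' tame).
Qed.
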